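(* Let $\Omega\subset\mathbb R^2$ be a compact convex set with non-empty interior. Then for every unit vector $\theta\in\mathbb R^2$, $$\bigl|\langle c(\partial\Omega)-c(\Omega),\theta\rangle\bigr|\le \frac16\, w_\Omega(\theta).$$
   Context: $c(\Omega)$ denotes the center of mass of $\Omega$ with respect to area (Lebesgue measure), i.e. $c(\Omega)=\frac{1}{\mathrm{Area}(\Omega)}\int_\Omega z\,dz$. $c(\partial\Omega)$ denotes the center of mass of the boundary curve $\partial\Omega$ with respect to arc length (one-dimensional Hausdorff measure). For a unit vector $\theta$, $w_\Omega(\theta)=\max_{z\in\Omega}\langle z,\theta\rangle-\min_{z\in\Omega}\langle z,\theta\rangle$ is the width of $\Omega$ in the direction $\theta$. *)

(* Defs.v *)
From HB Require Import structures.
From mathcomp Require Import all_boot all_order all_algebra.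
From mathcomp Require Import all_classical all_reals all_analysis.

Set Implicit Arguments.
Unset Strict Implicit.
Unset Printing Implicit Defensive.

Import Order.TTheory GRing.Theory Num.Theory.
Import numFieldNormedType.Exports.

Local Open Scope classical_set_scope.
Local Open Scope ring_scope.

(* The plane is [R * R]. Its library norm is the max norm, which yields the
   usual topology but not the Euclidean metric; [dot] and [enorm] provide the
   Euclidean structure. *)
Section euclidean_plane.
Context {R : realType}.
Implicit Types (p q z theta : R * R) (A U : set (R * R)).

Definition dot p q : R := p.1 * q.1 + p.2 * q.2.

Definition enorm p : R := Num.sqrt (dot p p).

(* The element 0 is added so that the empty set has diameter 0, not -oo. *)
Definition diam U : \bar R :=
  ereal_sup (0%E |` [set (enorm (p - q))%:E | p in U & q in U]).

Definition boundary A : set (R * R) := closure A `\` interior A.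

(* On a compact nonempty set the sup and inf are the max and min. *)
Definition width A theta : R :=
  sup [set dot z theta | z in A] - inf [set dot z theta | z in A].

Definition hausdorff1_delta (delta : R) A : \bar R :=
  ereal_inf [set (\sum_(0 <= k <oo) diam (U k))%E | U in
    [set U : (set (R * R))^nat |
      (forall k, diam (U k) <= delta%:E)%E /\ A `<=` \bigcup_k U k]].

(* One-dimensional Hausdorff outer measure, with the normalization for which
   a segment has measure its length. *)
Definition hausdorff1 A : \bar R :=
  ereal_sup [set hausdorff1_delta delta A | delta in [set delta | 0 < delta]].

End euclidean_plane.

Section hausdorff1_outer_measure.
Context {R : realType}.
Implicit Types (A U : set (R * R)) (delta : R).
Local Open Scope ereal_scope.

Lemma diam_ge0 U : 0 <= diam U.
Proof. by apply: ereal_sup_ubound; left. Qed.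

Lemma diam0 : diam (set0 : set (R * R)) = 0.
Proof.
apply/eqP; rewrite eq_le diam_ge0 andbT; apply: ge_ereal_sup.
by move=> _ [->//|[p []]].
Qed.

Lemma hausdorff1_delta_ge0 delta A : 0 <= hausdorff1_delta delta A.
Proof.
apply: le_ereal_inf_tmp => _ [U _ <-].
by apply: nneseries_ge0 => *; exact: diam_ge0.
Qed.

Lemma hausdorff1_delta0 delta : (0 < delta)%R ->
  hausdorff1_delta delta set0 = 0.
Proof.
move=> d0; apply/eqP; rewrite eq_le hausdorff1_delta_ge0 andbT.
apply: ereal_inf_lbound; exists (fun=> set0); last first.
  by rewrite eseries0// => *; exact: diam0.
by split => // k; rewrite diam0 lee_fin ltW.
Qed.

Lemma le_hausdorff1_delta delta :
  {homo hausdorff1_delta delta : A B / A `<=` B >-> A <= B}.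
Proof.
move=> A B AB; apply/ereal_inf_le_tmp => x [U [dU BU] <-].
by exists U => //; split => //; exact: subset_trans BU.
Qed.

(* Every set is measurable in this space, so that [mu_ext] over it allows
   covers by arbitrary sets. *)
Let T := g_sigma_algebraType [set: set (R * R)].

Let gauge delta (U : set T) : \bar R :=
  if diam U <= delta%:E then diam U else +oo.

Let gauge_ge0 delta U : 0 <= gauge delta U.
Proof. by rewrite /gauge; case: ifP => // _; exact: diam_ge0. Qed.

Let hausdorff1_deltaE delta A : hausdorff1_delta delta A = mu_ext (gauge delta) A.
Proof.
apply/eqP; rewrite eq_le; apply/andP; split; last first.
  apply/ereal_inf_le_tmp => _ [U [dU AU] <-]; exists U.
    by split => // k; exact: sub_sigma_algebra.
  by apply: eq_eseriesr => k _; rewrite /gauge dU.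
apply: le_ereal_inf_tmp => _ [U [_ AU] <-].
have [dU|] := pselect (forall k, diam (U k) <= delta%:E).
  apply: ereal_inf_lbound; exists U => //.
  by apply: eq_eseriesr => k _; rewrite /gauge dU.
move=> /existsNP[k /negP dUk].
have gUk : gauge delta (U k) = +oo by rewrite /gauge (negbTE dUk).
rewrite (eseries_pinfty _ _ gUk) ?leey// => n _.
by rewrite -ltNye (lt_le_trans _ (gauge_ge0 _ _)).
Qed.

Lemma hausdorff1_delta_sigma_subadditive delta :
  sigma_subadditive (@hausdorff1_delta R delta).
Proof.
move=> F; rewrite hausdorff1_deltaE.
under eq_eseriesr do rewrite hausdorff1_deltaE.
by apply: mu_ext_sigma_subadditive => X; exact: gauge_ge0.
Qed.

Lemma hausdorff1_ge0 A : 0 <= hausdorff1 A.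
Proof.
apply: le_trans (hausdorff1_delta_ge0 1%R A) _.
by apply: ereal_sup_ubound; exists 1%R => //=.
Qed.

Lemma hausdorff1_0 : hausdorff1 (set0 : set (R * R)) = 0.
Proof.
apply/eqP; rewrite eq_le hausdorff1_ge0 andbT; apply: ge_ereal_sup.
by move=> _ [delta d0 <-]; rewrite hausdorff1_delta0.
Qed.

Lemma le_hausdorff1 : {homo @hausdorff1 R : A B / A `<=` B >-> A <= B}.
Proof.
move=> A B AB; apply: ge_ereal_sup => _ [delta d0 <-].
apply: le_trans (le_hausdorff1_delta delta AB) _.
by apply: ereal_sup_ubound; exists delta.
Qed.

Lemma hausdorff1_sigma_subadditive : sigma_subadditive (@hausdorff1 R).
Proof.
move=> F; apply: ge_ereal_sup => _ [delta d0 <-].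
apply: le_trans (hausdorff1_delta_sigma_subadditive delta F) _.
apply: lee_nneseries => [k _ _|k _]; first exact: hausdorff1_delta_ge0.
by apply: ereal_sup_ubound; exists delta.
Qed.

HB.instance Definition _ := isOuterMeasure.Build R (R * R)%type
  (@hausdorff1 R) hausdorff1_0 hausdorff1_ge0 le_hausdorff1
  hausdorff1_sigma_subadditive.

End hausdorff1_outer_measure.

Section centers_of_mass.
Context {R : realType}.
Implicit Type A : set (R * R).

Definition area :
    {measure set (measurableTypeR R * measurableTypeR R) -> \bar R} :=
  (lebesgue_measure \x lebesgue_measure)%E.

(* Hausdorff measure on the sigma-algebra of Caratheodory measurable sets. *)
Definition arclength :
    {measure set (caratheodory_type (@hausdorff1 R)) -> \bar R} :=
  let H : {outer_measure set (R * R) -> \bar R} := @hausdorff1 R in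
  (H : set (caratheodory_type H) -> \bar R).

(* The integrals are real-valued and componentwise. [fine] sends the measure to
   R; it is positive and finite for the convex bodies considered here. *)
Definition area_center A : R * R :=
  ((\int[area]_(z in A) z.1) / fine (area A),
   (\int[area]_(z in A) z.2) / fine (area A)).

Definition boundary_center A : R * R :=
  ((\int[arclength]_(z in boundary A) z.1) / fine (arclength (boundary A)),
   (\int[arclength]_(z in boundary A) z.2) / fine (arclength (boundary A))).

End centers_of_mass.

(* Main.v *)
Require Import Defs.
From HB Require Import structures.
From mathcomp Require Import all_boot all_order all_algebra.
From mathcomp Require Import all_classical all_reals all_analysis.
From mathcomp Require Import measurable_realfun.
From mathcomp Require Import ring lra.

Set Implicit Arguments.
Unset Strict Implicit.
Unset Printing Implicit Defensive.

Import Order.TTheory GRing.Theory Num.Theory.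
Import numFieldNormedType.Exports.

Local Open Scope classical_set_scope.
Local Open Scope ring_scope.

(** The centers of mass of the body and of its boundary are compared in a
    direction [theta].  Replacing [theta] by its opposite, only
    [<c(Omega) - c(boundary), theta> <= w / 6] has to be shown, [w] being the
    width.  In orthonormal coordinates [t = <z, theta>] and [y], the body is
    [{a <= t <= b, - down t <= y <= up t}] with [up] and [down] concave.

    The length of the boundary is decomposed in the way of Crofton: up to an
    error [e |x|], the Euclidean norm of [(x, y)] is a mean of finitely many
    seminorms [|y - k x|] ([euclidean_norm_mean]).  Both the perimeter and the
    first moment of the boundary are then means over [k] of the corresponding
    quantities for the measure [|dy - k dt|] on the boundary curve, and the
    inequality to be shown is linear in these, so that it suffices to have it
    for each [k].  There the total mass is [2 W], where [W] is the sum of the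
    maxima of the concave functions [up - k t] and [down + k t], and the first
    moment is the integral of [2 W] minus the climbs (the variation up to [t])
    of these two functions.  This one-dimensional inequality is
    [chord_vs_climb_moment].  The difference of its two sides is at least a
    sum of two squares, by two sharp lower bounds on the first moment of a
    convex function, [convex_moment_right] and [convex_moment_left].

    Three facts link this to the measures in the statement.  The Hausdorff
    measure of an arc is at most the increment of any function that dominates
    its chords ([hausdorff1_le_image]) and at least the length of its
    projection ([hausdorff1_ge_projection]).  The first moment of the boundary
    is the integral over [t] of the length of the part beyond [t]
    ([layer_cake]).  Area integrals are computed by Fubini in the rotated
    coordinates ([integral_rot], [integral_body]). *)

(** * Integrals over a segment *)

(** A constant rather than an abbreviation, so that tactics for rings and for
    linear arithmetic see each integral as an atom. *)
Definition segint {R : realType} (a b : R) (f : R -> R) : R :=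
  \int[lebesgue_measure]_(t in `[a, b]) f t.

Notation "\int_ ( a , b ) f" := (segint a b f)
  (at level 36, a at level 0, b at level 0, f at level 36) : ring_scope.

Section segment_integral.
Context {R : realType}.
Implicit Types (a b c : R) (f g : R -> R).

Lemma continuous_integrable a b f : continuous f ->
  (@lebesgue_measure R).-integrable `[a, b] (EFin \o f).
Proof.
move=> cf; apply: continuous_compact_integrable.
  exact: segment_compact.
exact: continuous_subspaceT.
Qed.

Lemma int_lin a b f g x y : continuous f -> continuous g ->
  \int_(a, b) (fun t => x * f t + y * g t) =
  x * \int_(a, b) f + y * \int_(a, b) g.
Proof.
move=> cf cg; rewrite /segint RintegralD //=; last 2 first.
- by apply: continuous_integrable => t; apply: cvgM; [exact: cvg_cst|exact: cf].
- by apply: continuous_integrable => t; apply: cvgM; [exact: cvg_cst|exact: cg].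
by rewrite !RintegralZl //; apply: continuous_integrable.
Qed.

Lemma int_le a b f g : continuous f -> continuous g ->
  (forall t, a <= t <= b -> f t <= g t) -> \int_(a, b) f <= \int_(a, b) g.
Proof.
move=> cf cg fg; apply: (le_Rintegral _ (continuous_integrable _ _ cf)
                        (continuous_integrable _ _ cg)) => //.
Qed.

Lemma int_quad a b (x y z : R) : a <= b ->
  \int_(a, b) (fun t => x + y * (t - a) + z * (t - a) ^+ 2) =
  x * (b - a) + y / 2 * (b - a) ^+ 2 + z / 3 * (b - a) ^+ 3.
Proof.
rewrite /segint le_eqVlt => /predU1P[->|ab].
  by rewrite set_itv1 Rintegral_set1 !subrr !expr0n/= !mulr0 !addr0.
pose F t := x * (t - a) + y / 2 * (t - a) ^+ 2 + z / 3 * (t - a) ^+ 3 : R.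
have dF t : is_derive (t : R) (1 : R) F (x + y * (t - a) + z * (t - a) ^+ 2).
  rewrite /F; apply: is_derive_eq; rewrite /GRing.scale/=; lra.
rewrite /Rintegral (@continuous_FTC2 _ _ F) //=.
- by rewrite /F !subrr !expr0n/= !mulr0 !addr0 subr0.
- apply: continuous_subspaceT => t.
  apply: cvgD; [apply: cvgD; [exact: cvg_cst|]|]; apply: cvgM; try exact: cvg_cst.
    by apply: cvgB; [exact: cvg_id|exact: cvg_cst].
  by apply: cvgM; apply: cvgB; [exact: cvg_id|exact: cvg_cst|exact: cvg_id|exact: cvg_cst].
- have cF : continuous F.
    by move=> t; apply/differentiable_continuous/derivable1_diffP; have [] := dF t.
  split.
  - by move=> t _; have [] := dF t.
  - by apply: cvg_at_right_filter; exact: cF.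
  - by apply: cvg_at_left_filter; exact: cF.
- by move=> t _; rewrite derive1E; have [] := dF t.
Qed.

Lemma eq_int a b f g : (forall t, a <= t <= b -> f t = g t) ->
  \int_(a, b) f = \int_(a, b) g.
Proof.
by move=> fg; apply: eq_Rintegral => t; rewrite inE/= in_itv/=; exact: fg.
Qed.

Lemma intZ a b f x : continuous f ->
  \int_(a, b) (fun t => x * f t) = x * \int_(a, b) f.
Proof.
by move=> cf; rewrite /segint RintegralZl//; exact: continuous_integrable.
Qed.

Lemma int_ge0 a b f : (forall t, a <= t <= b -> 0 <= f t) -> 0 <= \int_(a, b) f.
Proof. by move=> f0; apply: Rintegral_ge0 => t; rewrite /= in_itv/=; exact: f0. Qed.

Lemma int_zero a b f : (forall t, a <= t <= b -> f t = 0) -> \int_(a, b) f = 0.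
Proof.
move=> f0; rewrite /segint (@eq_Rintegral _ _ _ _ _ (fun=> 0)); last first.
  by move=> t; rewrite inE/= in_itv/=; exact: f0.
by rewrite Rintegral_cst // mul0r.
Qed.

Lemma int_split a b c f : a <= c <= b -> continuous f ->
  \int_(a, b) f = \int_(a, c) f + \int_(c, b) f.
Proof.
move=> /andP[ac cb] cf.
have cI : (@lebesgue_measure R).-integrable `[a, b] (EFin \o f).
  exact: continuous_integrable.
rewrite -[LHS](subrK (\int_(a, c) f)) addrC; congr (_ + _); rewrite /segint.
rewrite Rintegral_itvB//.
rewrite Rintegral_itv_obnd_cbnd//.
apply: integrableS (continuous_integrable c b cf) => //.
by move=> t /=; rewrite !in_itv/= => /andP[/ltW-> ->].
Qed.

Lemma int_sum a b n (g : nat -> R -> R) : (forall i, continuous (g i)) ->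
  continuous (fun t => \sum_(0 <= i < n) g i t) /\
  \int_(a, b) (fun t => \sum_(0 <= i < n) g i t) = \sum_(0 <= i < n) \int_(a, b) (g i).
Proof.
move=> cg; elim: n => [|n [IHc IH]].
  rewrite (_ : (fun t => _) = fun=> 0); last by apply/funext => t; rewrite big_geq.
  by rewrite big_geq// int_zero//; split=> // t; exact: cvg_cst.
rewrite (_ : (fun t => _) = fun t => 1 * (\sum_(0 <= i < n) g i t) + 1 * g n t).
  rewrite int_lin// big_nat_recr//= IH !mul1r; split=> // t.
  by apply: cvgD; apply: cvgM; [exact: cvg_cst|exact: IHc|exact: cvg_cst|exact: cg].
by apply/funext => t; rewrite big_nat_recr//= !mul1r.
Qed.

Lemma int_gt0 a b f : a < b -> continuous f -> (forall t, a <= t <= b -> 0 <= f t) ->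
  (forall t, a < t < b -> 0 < f t) -> 0 < \int_(a, b) f.
Proof.
move=> ab cf f0 fpos.
pose l := (3 * a + b) / 4; pose r := (a + 3 * b) / 4.
have [al [lr rb]] : a < l /\ l < r /\ r < b by rewrite /l /r; lra.
clearbody l r.
have [x xlr xmin] := @EVT_min R f l r (ltW lr) (continuous_subspaceT cf).
rewrite (@int_split a b l) ?(@int_split l b r)//; last 2 first.
- by apply/andP; split; lra.
- by apply/andP; split; lra.
have fx : 0 < f x.
  by apply: fpos; move: xlr; rewrite in_itv/= => /andP[? ?]; apply/andP; split; lra.
have h1 : 0 <= \int_(a, l) f.
  by apply: int_ge0 => t /andP[? ?]; apply: f0; apply/andP; split; lra.
have h2 : 0 <= \int_(r, b) f.
  by apply: int_ge0 => t /andP[? ?]; apply: f0; apply/andP; split; lra.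
have : \int_(l, r) (fun t => f x + 0 * (t - l) + 0 * (t - l) ^+ 2) <= \int_(l, r) f.
  apply: int_le => // [t|t tlr].
    apply: cvgD; [apply: cvgD; [exact: cvg_cst|]|]; apply: cvgM; try exact: cvg_cst.
      by apply: cvgB; [exact: cvg_id|exact: cvg_cst].
    by apply: cvgM; apply: cvgB; [exact: cvg_id|exact: cvg_cst|exact: cvg_id|exact: cvg_cst].
  by rewrite !mul0r !addr0; apply: xmin; rewrite in_itv.
rewrite int_quad; last exact: ltW.
rewrite !mul0r !addr0.
have : 0 < f x * (r - l) by apply: mulr_gt0 => //; lra.
lra.
Qed.

End segment_integral.

(** * First moments of convex functions *)

(** Recursion on the syntax of the function: trying the continuity lemmas one
    after the other makes unification unfold the real operations. *)
Ltac continuity_at := lazymatch goal with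
  | |- context [fmap (fun t => t) _] => exact: cvg_id
  | |- context [fmap (fun t => ?c) _] => exact: cvg_cst
  | |- context [fmap (fun t => Algebra.add _ _) _] => apply: cvgD; continuity_at
  | |- context [fmap (fun t => Algebra.opp _) _] => apply: cvgN; continuity_at
  | |- context [fmap (fun t => GRing.mul _ _) _] => apply: cvgM; continuity_at
  | |- _ => first [match goal with H : continuous _ |- _ => exact: H end
                  | exact: cvg_id | exact: cvg_cst]
  end.

Ltac continuity := let x := fresh in move=> x; rewrite /continuous_at; continuity_at.

Section convex_moments.
Context {R : realType}.
Implicit Types (a b c : R) (f : R -> R).

(** Convexity in the form of three points and without division, which linear
    arithmetic can use as it is. *)
Definition convex_on a b f := forall u v w, a <= u -> u <= v -> v <= w -> w <= b ->
  (w - u) * f v <= (w - v) * f u + (v - u) * f w.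

(** Let [d] be the point at two thirds of the segment.  The line through
    [(a, 0)] and [(d, f d)] is above [f] before [d] and below [f] after [d],
    and its own first moment about [d] vanishes.  Equality holds for linear
    functions vanishing at [a]. *)
Lemma convex_moment_right a b f : a < b -> continuous f -> convex_on a b f ->
  f a = 0 ->
  2 / 3 * (b - a) * \int_(a, b) f <= \int_(a, b) (fun t => (t - a) * f t).
Proof.
move=> ab cf vf fa0.
pose d := a + 2 / 3 * (b - a); pose k := f d / (d - a).
have da : 0 < d - a by rewrite /d; lra.
have db : d <= b by rewrite /d; lra.
have kE : k * (d - a) = f d by rewrite /k divfK // gt_eqF.
have le0 : 0 <= \int_(a, b) (fun t => 1 * ((t - d) * f t) +
    (- k) * ((t - d) * (t - a))).
  apply: int_ge0 => t /andP[at_ tb].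
  suff: 0 <= (t - d) * (f t - k * (t - a)) by lra.
  have [td|dt] := leP t d.
    have := vf a t d (lexx _) at_ td db; rewrite fa0 mulr0 add0r -kE => h.
    have {}h : f t <= k * (t - a).
      by rewrite -(ler_pM2l da); apply: le_trans h _; lra.
    by apply: mulr_le0; lra.
  have := vf a d t (lexx _) _ (ltW dt) tb; rewrite fa0 mulr0 add0r -kE => h.
  have {}h : k * (t - a) <= f t.
    by rewrite -(ler_pM2l da); apply: le_trans (h _); lra.
  by apply: mulr_ge0; lra.
rewrite int_lin in le0; [|continuity|continuity].
have e1 : \int_(a, b) (fun t => (t - d) * (t - a)) = 0.
  rewrite (_ : (fun t => _) = (fun t => 0 + (a - d) * (t - a) + 1 * (t - a) ^+ 2)).
    by rewrite int_quad ?ltW // /d; lra.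
  by apply/funext => t; ring.
have e2 : \int_(a, b) (fun t => (t - d) * f t) =
    1 * \int_(a, b) (fun t => (t - a) * f t) + (- (d - a)) * \int_(a, b) f.
  by rewrite -int_lin; [congr segint; apply/funext => t; ring|continuity|].
by move: le0; rewrite e1 e2 mulr0 addr0 /d; lra.
Qed.

Lemma int_truncated_moment a b r l : 0 < r -> r <= b - a ->
  \int_(a, b) (fun t => (t - a - l) * Num.max 0 (1 - (t - a) / r)) =
  r ^+ 2 / 6 - l * r / 2.
Proof.
move=> r0 rab.
have cm : continuous (fun t : R => Num.max 0 (1 - (t - a) / r)).
  by move=> t; apply: (@continuous_max _ _ (cst (0 : R)) (fun t : R => 1 - (t - a) / r));
    [exact: cvg_cst|move: t; continuity].
have cf : continuous (fun t : R => (t - a - l) * Num.max 0 (1 - (t - a) / r)).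
  by continuity.
rewrite (@int_split _ a b (a + r)) //; last by apply/andP; split; lra.
rewrite [X in _ + X]int_zero ?addr0; last first.
  move=> t /andP[art tb]; rewrite max_l ?mulr0//.
  by rewrite subr_le0 ler_pdivlMr//; lra.
rewrite (_ : segint a _ _ = \int_(a, a + r)
  (fun t => - l + (1 + l / r) * (t - a) + (- r^-1) * (t - a) ^+ 2)); last first.
  apply: eq_int => t /andP[at_ tar].
  rewrite max_r; last by rewrite subr_ge0 ler_pdivrMr//; lra.
  by field; rewrite gt_eqF.
rewrite int_quad; last by lra.
by rewrite (_ : a + r - a = r); [field; rewrite gt_eqF|ring].
Qed.

(** Given [f a], the right side is minimal at a truncated affine function
    [f a * max 0 (1 - (t - a) / r)], where it is [f a * (r ^ 2 / 6 - l r / 2)];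
    the worst [r] is [3 l / 2].  The bound is linear in [f], hence can be added
    over several functions before the best [l] is chosen. *)
Lemma convex_moment_left a b f l : a < b -> continuous f -> convex_on a b f ->
  f b = 0 -> (forall t, a <= t <= b -> 0 <= f t) -> 0 <= l ->
  - (3 / 8) * l ^+ 2 * f a <=
    \int_(a, b) (fun t => (t - a) * f t) - l * \int_(a, b) f.
Proof.
move=> ab cf vf fb0 f0 l0.
have fa0 : 0 <= f a by apply: f0; rewrite lexx ltW.
have fle t : a <= t <= b -> (b - a) * f t <= (b - t) * f a.
  by move=> /andP[at_ tb]; have := vf a t b (lexx _) at_ tb (lexx _);
    rewrite fb0 mulr0 addr0.
have -> : \int_(a, b) (fun t => (t - a) * f t) - l * \int_(a, b) f =
    \int_(a, b) (fun t => 1 * ((t - a) * f t) + (- l) * f t).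
  by rewrite int_lin; [ring|continuity|].
move: fa0; rewrite le_eqVlt => /predU1P[fa0|fa0].
  rewrite -fa0 mulr0; apply: int_ge0 => t tab.
  suff -> : f t = 0 by rewrite !mulr0 addr0.
  apply/eqP; rewrite eq_le f0// andbT.
  by have := fle t tab; rewrite -fa0 mulr0 pmulr_rle0//; lra.
move: l0; rewrite le_eqVlt => /predU1P[<-|l_gt0].
  rewrite expr0n/= mulr0 mul0r; apply: int_ge0 => t tab.
  have /andP[at_ _] := tab.
  by rewrite oppr0 mul0r addr0 mul1r mulr_ge0 ?f0// subr_ge0.
(* The line through the points of the graph over a and a + l, or over a and b
   when l is too large, vanishes at a + r; it is above f until a + l, and its
   positive part is below f afterwards. *)
have [r [r0 rab rlo rhi]] : exists r, [/\ 0 < r, r <= b - a,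
    forall t, a <= t <= b -> t - a <= l -> f t <= f a * Num.max 0 (1 - (t - a) / r) &
    forall t, a <= t <= b -> l <= t - a -> f a * Num.max 0 (1 - (t - a) / r) <= f t].
  have maxE r t : f a * Num.max 0 (1 - (t - a) / r) =
      Num.max 0 (f a - f a * (t - a) / r).
    by rewrite maxr_pMr ?mulr0 ?ltW// mulrBr mulr1 mulrA.
  have [lba|bal] := ltP l (b - a); last first.
    exists (b - a); split=> //; first lra.
    - move=> t tab _; rewrite maxE le_max; apply/orP; right.
      rewrite -(ler_pM2l (_ : 0 < b - a)); last lra.
      rewrite (le_trans (fle t tab))// mulrBr mulrCA divff ?gt_eqF; lra.
    - move=> t tab lt_; rewrite maxE ge_max f0//=.
      have -> : t - a = b - a by move: tab => /andP[? ?]; lra.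
      by rewrite mulfK ?subrr ?f0// gt_eqF// subr_gt0.
  have fp : f (a + l) < f a.
    have lab : a <= a + l <= b by apply/andP; split; lra.
    rewrite -(ltr_pM2l (_ : 0 < b - a)); last lra.
    apply: le_lt_trans (fle _ lab) _; rewrite ltr_pM2r//; lra.
  have dp : 0 < f a - f (a + l) by lra.
  have rE t : f a * (t - a) / (l * f a / (f a - f (a + l))) =
      (f a - f (a + l)) * (t - a) / l.
    by field; rewrite ?gt_eqF.
  exists (l * f a / (f a - f (a + l))); split.
  - by rewrite divr_gt0// mulr_gt0.
  - have lab : a <= a + l <= b by apply/andP; split; lra.
    by rewrite ler_pdivrMr//; have := fle _ lab; lra.
  - move=> t /andP[at_ tb] tl; rewrite maxE rE le_max; apply/orP; right.
    rewrite -(ler_pM2l l_gt0) mulrBr mulrCA divff ?gt_eqF//.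
    have := vf a t (a + l) (lexx _) at_ _ _; lra.
  - move=> t /andP[at_ tb] tl; rewrite maxE rE ge_max f0 ?at_//=.
    rewrite -(ler_pM2l l_gt0) mulrBr mulrCA divff ?gt_eqF//.
    have := vf a (a + l) t (lexx _) _ _ tb; lra.
have cm : continuous (fun t : R => Num.max 0 (1 - (t - a) / r)).
  by move=> t; apply: (@continuous_max _ _ (cst (0 : R)) (fun t : R => 1 - (t - a) / r));
    [exact: cvg_cst|move: t; continuity].
have cmm : continuous (fun t : R => (t - a - l) * Num.max 0 (1 - (t - a) / r)).
  by continuity.
apply: (@le_trans _ _ (\int_(a, b) (fun t => f a *
    ((t - a - l) * Num.max 0 (1 - (t - a) / r)) + 0 * t))).
  rewrite int_lin//; last by continuity.
  rewrite int_truncated_moment// mul0r addr0.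
  have : 0 <= f a * (r - 3 / 2 * l) ^+ 2 by rewrite mulr_ge0 ?sqr_ge0// ltW.
  by lra.
apply: int_le.
- by move=> t; apply: cvgD; [apply: cvgM; [exact: cvg_cst|exact: cmm]|apply: cvgM; [exact: cvg_cst|exact: cvg_id]].
- by continuity.
move=> t tab; rewrite mul0r addr0.
rewrite (_ : _ + _ = (t - a - l) * f t); last by ring.
rewrite mulrCA; have [tl|lt_] := leP (t - a) l.
  by apply: ler_wnM2l; [lra|exact: rlo].
by apply: ler_wpM2l; [lra|apply: rhi => //; exact: ltW].
Qed.

End convex_moments.

(** * The one-dimensional inequality *)

Section climb.
Context {R : realType}.
Implicit Types (a b c : R) (f : R -> R).

Definition concave_on a b f := forall u v w, a <= u -> u <= v -> v <= w -> w <= b ->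
  (w - v) * f u + (v - u) * f w <= (w - u) * f v.

Definition max_at a b f c := a <= c <= b /\ forall t, a <= t <= b -> f t <= f c.

Lemma max_at_exists a b f : a <= b -> continuous f -> exists c, max_at a b f c.
Proof.
move=> ab cf; have [c cab fc] := @EVT_max _ f a b ab (continuous_subspaceT cf).
by exists c; split; [move: cab; rewrite in_itv | move=> t tab; apply: fc; rewrite in_itv].
Qed.

Lemma concave_nondecreasing a b f c u v : concave_on a b f -> max_at a b f c ->
  a <= u -> u <= v -> v <= c -> f u <= f v.
Proof.
move=> vf [/andP[ac cb] fc] au uv vc.
move: (uv); rewrite le_eqVlt => /predU1P[->//|uv'].
rewrite -(ler_pM2l (_ : 0 < c - u)); last lra.
have := vf u v c au uv vc cb.
have : (v - u) * f u <= (v - u) * f c.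
  by apply: ler_wpM2l; [lra|apply: fc; apply/andP; split; lra].
lra.
Qed.

Lemma concave_nonincreasing a b f c u v : concave_on a b f -> max_at a b f c ->
  c <= u -> u <= v -> v <= b -> f v <= f u.
Proof.
move=> vf [/andP[ac cb] fc] cu uv vb.
move: (uv); rewrite le_eqVlt => /predU1P[->//|uv'].
rewrite -(ler_pM2l (_ : 0 < v - c)); last lra.
have := vf c u v ac cu uv vb.
have : (v - u) * f v <= (v - u) * f c.
  by apply: ler_wpM2l; [lra|apply: fc; apply/andP; split; lra].
lra.
Qed.

(** For [f] concave with maximum at [c], this is, up to a constant, the
    variation of [f] up to [t]: [f] before [c], and the reflection of [f] in the
    level [f c] afterwards. *)
Definition climb f c t := f (Num.min t c) + f c - f (Num.max t c).

Lemma climbl f c t : t <= c -> climb f c t = f t.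
Proof. by move=> tc; rewrite /climb min_l// max_r// addrK. Qed.

Lemma climbr f c t : c <= t -> climb f c t = 2 * f c - f t.
Proof. by move=> tc; rewrite /climb min_r// max_l//; ring. Qed.

Lemma climb_continuous f c : continuous f -> continuous (climb f c).
Proof.
move=> cf t; apply: cvgB; [apply: cvgD; [|exact: cvg_cst]|].
  apply: (@continuous_comp _ _ _ (fun t => Num.min t c) f); last exact: cf.
  by apply: (@continuous_min _ _ id (cst c)); [exact: cvg_id|exact: cvg_cst].
apply: (@continuous_comp _ _ _ (fun t => Num.max t c) f); last exact: cf.
by apply: (@continuous_max _ _ id (cst c)); [exact: cvg_id|exact: cvg_cst].
Qed.

Lemma climb_dominates a b f c u v : concave_on a b f -> max_at a b f c ->
  a <= u -> u <= v -> v <= b -> `|f v - f u| <= climb f c v - climb f c u.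
Proof.
move=> vf mf au uv vb; have up := concave_nondecreasing vf mf.
have dn := concave_nonincreasing vf mf.
have [/andP[ac cb] fc] := mf.
have [vc|cv] := leP v c.
  rewrite !climbl ?(le_trans uv)// ger0_norm// subr_ge0.
  exact: up.
have [uc|cu] := leP u c.
  rewrite (climbl _ uc) (climbr _ (ltW cv)) ler_norml.
  have fu : f u <= f c by apply: fc; apply/andP; split; lra.
  have fv : f v <= f c by apply: fc; apply/andP; split; lra.
  by apply/andP; split; lra.
rewrite (climbr _ (ltW cv)) (climbr _ (ltW cu)) ler0_norm; first lra.
by rewrite subr_le0; apply: dn => //; exact: ltW.
Qed.

(** Away from the maximum, a concave function is monotone and its increments
    are its variation. *)
Lemma climb_eq a b f c u v : concave_on a b f -> max_at a b f c ->
  a <= u -> u <= v -> v <= b -> v <= c \/ c <= u ->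
  climb f c v - climb f c u = `|f v - f u|.
Proof.
move=> vf mf au uv vb [vc|cu].
  rewrite !climbl ?(le_trans uv)// ger0_norm// subr_ge0.
  exact: (concave_nondecreasing vf mf).
rewrite !climbr ?(le_trans cu)// ler0_norm; first ring.
rewrite subr_le0; exact: (concave_nonincreasing vf mf).
Qed.

Lemma climb_nondecreasing a b f c u v : concave_on a b f -> max_at a b f c ->
  a <= u -> u <= v -> v <= b -> climb f c u <= climb f c v.
Proof.
move=> vf mf au uv vb; rewrite -subr_ge0.
exact: le_trans (climb_dominates vf mf au uv vb).
Qed.

(** [f c - f] splits into a part living before [c] and a part living after
    [c]; both are convex on the whole segment. *)
Lemma min_defect_convex a b f c : concave_on a b f -> max_at a b f c ->
  convex_on a b (fun t => f c - f (Num.min t c)).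
Proof.
move=> vf mf u v w au uv vw wb; have [/andP[ac cb] fc] := mf.
rewrite /=.
have /orP[wc|cw] := le_total w c.
  rewrite !min_l ?(le_trans vw)// ?(le_trans uv)// ?(le_trans vw)//.
  have := vf u v w au uv vw wb; lra.
have /orP[cv|vc] := le_total c v.
  rewrite !(min_r cw) (min_r cv) !subrr !mulr0 addr0.
  apply: mulr_ge0; first lra.
  rewrite subr_ge0 fc// le_min; have [] := leP u c => uc; apply/andP; split; lra.
rewrite (min_r cw) (min_l vc) (min_l (le_trans uv vc)).
have := vf u v c au uv vc cb.
have fuv : f u <= f v := concave_nondecreasing vf mf au uv vc.
have : 0 <= (w - c) * (f v - f u) by apply: mulr_ge0; lra.
lra.
Qed.

Lemma max_defect_convex a b f c : concave_on a b f -> max_at a b f c ->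
  convex_on a b (fun t => f c - f (Num.max t c)).
Proof.
move=> vf mf u v w au uv vw wb; have [/andP[ac cb] fc] := mf.
rewrite /=.
have /orP[cu|uc] := le_total c u.
  rewrite !max_l ?(le_trans cu)// ?(le_trans uv)//.
  have := vf u v w au uv vw wb; lra.
have /orP[vc|cv] := le_total v c.
  rewrite !(max_r uc) (max_r vc) !subrr !mulr0 add0r.
  apply: mulr_ge0; first lra.
  rewrite subr_ge0 fc//; have [] := leP w c => wc; apply/andP; split; lra.
rewrite (max_r uc) (max_l cv) (max_l (le_trans cv vw)).
have := vf c v w ac cv vw wb.
have fvw : f w <= f v := concave_nonincreasing vf mf cv vw wb.
have : 0 <= (c - u) * (f v - f w) by apply: mulr_ge0; lra.
lra.
Qed.

(** Read [f1] and [- f2] as the upper and the lower boundary of a convex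
    region: [f1 + f2] is the chord, [2 W] with [W = f1 c1 + f2 c2] is the total
    variation of the whole boundary including its two vertical sides, and the
    first integral on the right is the first moment of that variation, measured
    from [a].

    Put [u = W (b - a)], and let [al] and [be] be the integrals of the parts of
    [W - f1 - f2] before and after the maxima.  The moment bounds for convex
    functions reduce the claim to
    [0 <= (al - u / 2) ^ 2 / 3 + (be - u / 2) ^ 2]. *)
Lemma chord_vs_climb_moment a b f1 f2 c1 c2 : a < b ->
  continuous f1 -> continuous f2 -> concave_on a b f1 -> concave_on a b f2 ->
  max_at a b f1 c1 -> max_at a b f2 c2 -> 0 <= f1 a + f2 a ->
  0 < f1 c1 + f2 c2 ->
  2 * (f1 c1 + f2 c2) * \int_(a, b) (fun t => (t - a) * (f1 t + f2 t)) <=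
  (\int_(a, b) (fun t => 2 * (f1 c1 + f2 c2) - climb f1 c1 t - climb f2 c2 t) +
     (f1 c1 + f2 c2) * (b - a) / 3) * \int_(a, b) (fun t => f1 t + f2 t).
Proof.
move=> ab cf1 cf2 v1 v2 m1 m2 fa0 W0.
have [/andP[ac1 cb1] fc1] := m1; have [/andP[ac2 cb2] fc2] := m2.
set W := f1 c1 + f2 c2 in W0 *.
pose l (f : R -> R) c t := f c - f (Num.min t c).
pose r (f : R -> R) c t := f c - f (Num.max t c).
have ccomp f (g : R -> R) : continuous f -> continuous g -> continuous (fun t => f (g t)).
  by move=> cf cg t; exact: (continuous_comp (cg t) (cf (g t))).
have cmin c : continuous (fun t : R => Num.min t c).
  by move=> t; apply: (@continuous_min _ _ id (cst c)); [exact: cvg_id|exact: cvg_cst].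
have cmax c : continuous (fun t : R => Num.max t c).
  by move=> t; apply: (@continuous_max _ _ id (cst c)); [exact: cvg_id|exact: cvg_cst].
have cl f c : continuous f -> continuous (l f c).
  by move=> cf t; apply: cvgB; [exact: cvg_cst|exact: (ccomp _ _ cf (cmin c))].
have cr f c : continuous f -> continuous (r f c).
  by move=> cf t; apply: cvgB; [exact: cvg_cst|exact: (ccomp _ _ cf (cmax c))].
have lrE f c t : l f c t + r f c t = f c - f t.
  by rewrite /l /r/=; case: (leP t c) => _; lra.
have climbE f c t : climb f c t = f c - l f c t + r f c t.
  by rewrite /climb /l /r/=; case: (leP t c) => _; lra.
have lin f (g : R -> R) x : continuous f -> continuous g ->
    \int_(a, b) (fun t => x * f t + g t) = x * \int_(a, b) f + \int_(a, b) g.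
  move=> cf cg; rewrite -[X in _ = _ + X]mul1r -int_lin//.
  by congr segint; apply/funext => t; rewrite mul1r.
have linZ (g : R -> R) x : continuous g ->
    \int_(a, b) (fun t => x * g t) = x * \int_(a, b) g.
  by move=> cg; exact: intZ.
have lin5 (g0 g1 g2 g3 g4 : R -> R) (x0 x1 x2 x3 x4 : R) : continuous g0 -> continuous g1 ->
    continuous g2 -> continuous g3 -> continuous g4 ->
    \int_(a, b) (fun t => x0 * g0 t + (x1 * g1 t + (x2 * g2 t +
       (x3 * g3 t + x4 * g4 t)))) =
    x0 * \int_(a, b) g0 + (x1 * \int_(a, b) g1 + (x2 * \int_(a, b) g2 +
       (x3 * \int_(a, b) g3 + x4 * \int_(a, b) g4))).
  by move=> ? ? ? ? ?; rewrite !lin ?linZ//; continuity.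
have [cl1 cl2] := (cl _ c1 cf1, cl _ c2 cf2).
have [cr1 cr2] := (cr _ c1 cf1, cr _ c2 cf2).
have cmul (g : R -> R) : continuous g -> continuous (fun t => (t - a) * g t).
  by move=> cg; continuity.
pose u2 (t : R) : R := t - a.
have cid : continuous u2.
  by move=> t; apply: cvgB; [exact: cvg_id|exact: cvg_cst].
pose u1 : R -> R := cst 1.
have c_1 : continuous u1 by move=> t; exact: cvg_cst.
have one : \int_(a, b) u1 = b - a.
  rewrite (_ : u1 = (fun t : R => 1 + 0 * (t - a) + 0 * (t - a) ^+ 2)).
    by rewrite int_quad ?ltW//; lra.
  by apply/funext => t; rewrite /u1/=; ring.
have first_moment : \int_(a, b) u2 = (b - a) ^+ 2 / 2.
  rewrite (_ : u2 = (fun t : R => 0 + 1 * (t - a) + 0 * (t - a) ^+ 2)).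
    by rewrite int_quad ?ltW//; lra.
  by apply/funext => t; rewrite /u2; ring.
have fE t : f1 t + f2 t = W - l f1 c1 t - r f1 c1 t - l f2 c2 t - r f2 c2 t.
  by have := lrE f1 c1 t; have := lrE f2 c2 t; rewrite /W; lra.
set A := \int_(a, b) (fun t => f1 t + f2 t).
have AE : A = W * (b - a) - \int_(a, b) (l f1 c1) - \int_(a, b) (r f1 c1)
    - \int_(a, b) (l f2 c2) - \int_(a, b) (r f2 c2).
  rewrite -one.
  have h := lin5 _ _ _ _ _ W (-1) (-1) (-1) (-1) c_1 cl1 cr1 cl2 cr2.
  move: h; rewrite [X in X = _ -> _](_ : _ = A); last first.
    by congr segint; apply/funext => t; rewrite /u1 /u2/= fE; ring.
by move=> ->; ring.
have ME : \int_(a, b) (fun t => (t - a) * (f1 t + f2 t)) =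
    W * ((b - a) ^+ 2 / 2)
    - \int_(a, b) (fun t => (t - a) * l f1 c1 t)
    - \int_(a, b) (fun t => (t - a) * r f1 c1 t)
    - \int_(a, b) (fun t => (t - a) * l f2 c2 t)
    - \int_(a, b) (fun t => (t - a) * r f2 c2 t).
  rewrite -first_moment.
  have h := lin5 _ _ _ _ _ W (-1) (-1) (-1) (-1) cid (cmul _ cl1) (cmul _ cr1)
    (cmul _ cl2) (cmul _ cr2).
  move: h; rewrite [X in X = _ -> _](_ : _ = \int_(a, b) (fun t => (t - a) * (f1 t + f2 t))); last first.
    by congr segint; apply/funext => t; rewrite /u1 /u2/= fE; ring.
  by move=> ->; ring.
have NE : \int_(a, b) (fun t => 2 * W - climb f1 c1 t - climb f2 c2 t) =
    W * (b - a) + \int_(a, b) (l f1 c1) - \int_(a, b) (r f1 c1)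
    + \int_(a, b) (l f2 c2) - \int_(a, b) (r f2 c2).
  rewrite -one.
  have h := lin5 _ _ _ _ _ W 1 (-1) 1 (-1) c_1 cl1 cr1 cl2 cr2.
  move: h; rewrite [X in X = _ -> _](_ : _ = \int_(a, b) (fun t => 2 * W - climb f1 c1 t - climb f2 c2 t)); last first.
    by congr segint; apply/funext => t; rewrite /u1/= !climbE /W; ring.
  by move=> ->; ring.
pose al := \int_(a, b) (l f1 c1) + \int_(a, b) (l f2 c2).
pose be := \int_(a, b) (r f1 c1) + \int_(a, b) (r f2 c2).
have right1 := convex_moment_right ab cr1 (max_defect_convex v1 m1).
have right2 := convex_moment_right ab cr2 (max_defect_convex v2 m2).
have {}right1 : 2 / 3 * (b - a) * \int_(a, b) (r f1 c1) <=
    \int_(a, b) (fun t => (t - a) * r f1 c1 t).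
  by apply: right1; rewrite /r max_r// subrr.
have {}right2 : 2 / 3 * (b - a) * \int_(a, b) (r f2 c2) <=
    \int_(a, b) (fun t => (t - a) * r f2 c2 t).
  by apply: right2; rewrite /r max_r// subrr.
have l_ge0 f c : max_at a b f c -> forall t, a <= t <= b -> 0 <= l f c t.
  move=> [/andP[ac cb] fc] t /andP[at_ tb]; rewrite /l subr_ge0 fc//.
  by rewrite le_min at_ ac/= ge_min tb.
have al0 : 0 <= al by rewrite addr_ge0// int_ge0//; exact: l_ge0.
(* This value maximizes k * al - 3 / 8 * k ^ 2 * W, the bound obtained from the
   two parts before the maxima. *)
pose k := 4 * al / (3 * W).
have k0 : 0 <= k by rewrite divr_ge0 ?mulr_ge0// ltW.
have left1 : - (3 / 8) * k ^+ 2 * l f1 c1 a <=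
    \int_(a, b) (fun t => (t - a) * l f1 c1 t) - k * \int_(a, b) (l f1 c1).
  apply: convex_moment_left => //; [exact: min_defect_convex| |exact: l_ge0].
  by rewrite /l min_r// subrr.
have left2 : - (3 / 8) * k ^+ 2 * l f2 c2 a <=
    \int_(a, b) (fun t => (t - a) * l f2 c2 t) - k * \int_(a, b) (l f2 c2).
  apply: convex_moment_left => //; [exact: min_defect_convex| |exact: l_ge0].
  by rewrite /l min_r// subrr.
have left_sum : 2 / 3 * al ^+ 2 <=
    W * (\int_(a, b) (fun t => (t - a) * l f1 c1 t) +
         \int_(a, b) (fun t => (t - a) * l f2 c2 t)).
  have la : l f1 c1 a + l f2 c2 a <= W.
    by rewrite /l !min_l//; rewrite /W; lra.
  have kla : k ^+ 2 * (l f1 c1 a + l f2 c2 a) <= k ^+ 2 * W.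
    by rewrite ler_wpM2l ?sqr_ge0.
  have : W * (k * al - 3 / 8 * (k ^+ 2 * W)) <=
      W * (\int_(a, b) (fun t => (t - a) * l f1 c1 t) +
         \int_(a, b) (fun t => (t - a) * l f2 c2 t)).
    by rewrite ler_pM2l//; rewrite /al in kla *; lra.
  apply: le_trans; rewrite /k le_eqVlt; apply/orP; left; apply/eqP.
  by field; rewrite gt_eqF.
rewrite ME NE AE; set u := W * (b - a).
have : 0 <= (al - u / 2) ^+ 2 / 3 + (be - u / 2) ^+ 2.
  by rewrite addr_ge0 ?divr_ge0 ?sqr_ge0.
have : W * (2 / 3 * (b - a) * be) <=
    W * (\int_(a, b) (fun t => (t - a) * r f1 c1 t) +
         \int_(a, b) (fun t => (t - a) * r f2 c2 t)).
  by rewrite ler_pM2l//; rewrite /be; lra.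
move: left_sum; rewrite /al /be /u; lra.
Qed.
End climb.

(** * The Euclidean norm as a mean of seminorms *)

Section euclidean_norm_as_mean.
Context {R : realType}.
Implicit Types (x y e s : R) (n : nat).

Let q s := Num.sqrt (1 - s ^+ 2).

Let q_sqr s : -1 <= s <= 1 -> q s ^+ 2 = 1 - s ^+ 2.
Proof.
by move=> /andP[s1 s2]; rewrite sqr_sqrtr// subr_ge0 -real_normK ?num_real//
  exprn_ile1// ler_norml s1.
Qed.

Let q_dot u w : -1 <= u <= 1 -> -1 <= w <= 1 -> q u * q w + u * w <= 1.
Proof.
move=> u1 w1; have := q_sqr u1; have := q_sqr w1.
by have := sqr_ge0 (q u - q w); have := sqr_ge0 (u - w); nra.
Qed.

(** The scalar product of [(x, y)] with the unit vector [(q s, s)]. *)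
Let L x y s := y * s + x * q s.

Let L_concave x y : 0 <= x -> concave_on (-1) 1 (L x y).
Proof.
move=> x0 u v w u1 uv vw w1.
have v1 : -1 <= v <= 1 by apply/andP; split; lra.
have u1' : -1 <= u <= 1 by apply/andP; split; lra.
have w1' : -1 <= w <= 1 by apply/andP; split; lra.
suff H : (w - v) * q u + (v - u) * q w <= (w - u) * q v.
  have := ler_wpM2l x0 H; rewrite /L; lra.
have wv : 0 <= w - v by lra.
have vu : 0 <= v - u by lra.
have wu : 0 <= w - u by lra.
have q0 s : 0 <= q s by exact: sqrtr_ge0.
rewrite -ler_sqr ?nnegrE ?addr_ge0 ?mulr_ge0//.
have -> : ((w - v) * q u + (v - u) * q w) ^+ 2 =
  (w - v) ^+ 2 * q u ^+ 2 + (v - u) ^+ 2 * q w ^+ 2 +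
  2 * (w - v) * (v - u) * (q u * q w) by ring.
rewrite exprMn !q_sqr//.
have := ler_wpM2l (mulr_ge0 wv vu) (q_dot u1' w1'); lra.
Qed.

(** For [0 <= x], the function [L s = y s + x sqrt (1 - s ^ 2)] is concave on
    [[-1, 1]], goes from [- y] to [y] and has the Euclidean norm of [(x, y)] as
    maximum.  Its variation is thus twice that norm.  On a uniform grid, each
    increment of [L] is a multiple of [|y - k x|] with [k] depending on the cell
    only, and half the variation along the grid misses the maximum by at most
    [e * x] because [sqrt (1 - s ^ 2)] is uniformly continuous. *)
Lemma euclidean_norm_mean e : 0 < e -> exists n (k : nat -> R), (0 < n)%N /\
  forall x y, 0 <= x ->
    `|Num.sqrt (x ^+ 2 + y ^+ 2) - (\sum_(0 <= i < n) `|y - k i * x|) / n%:R|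
      <= e * x.
Proof.
move=> e0.
have [n n0 ne] : exists2 n, (0 < n)%N & 4 / n%:R <= e ^+ 2.
  exists (Num.truncn (4 / e ^+ 2)).+1 => //.
  rewrite ler_pdivrMr ?ltr0n// mulrC -ler_pdivrMr ?exprn_gt0//.
  by apply/ltW/truncnS_gt.
have n0' : 0 < n%:R :> R by rewrite ltr0n.
pose s i : R := -1 + 2 / n%:R * i%:R.
pose k i := - (q (s i.+1) - q (s i)) * (n%:R / 2).
exists n, k; split=> // x y x0.
set r := Num.sqrt _.
have s0 : s 0%N = -1 by rewrite /s mulr0 addr0.
have sn : s n = 1 by rewrite /s -mulrA mulVf ?gt_eqF//; lra.
have sS i : s i.+1 - s i = 2 / n%:R by rewrite /s -natr1; ring.
have s_mono i j : (i <= j)%N -> s i <= s j.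
  by move=> ij; rewrite /s lerD2l ler_wpM2l ?ler_nat// divr_ge0.
have s_in i : (i <= n)%N -> -1 <= s i <= 1.
  by move=> ni; rewrite -{1}s0 -sn !s_mono.
have Lm1 : L x y (s 0%N) = - y by rewrite /L s0 /q sqrrN expr1n subrr sqrtr0; ring.
have L1 : L x y (s n) = y by rewrite /L sn /q expr1n subrr sqrtr0; ring.
have step i : 2 / n%:R * `|y - k i * x| = `|L x y (s i.+1) - L x y (s i)|.
  rewrite -[2 / _]ger0_norm ?divr_ge0// -normrM; congr `|_|.
  rewrite (_ : L x y _ - _ = y * (s i.+1 - s i) + x * (q (s i.+1) - q (s i))).
    by rewrite sS /k; field; rewrite gt_eqF.
  by rewrite /L; ring.
have sumE : (\sum_(0 <= i < n) `|y - k i * x|) / n%:R =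
    (\sum_(0 <= i < n) `|L x y (s i.+1) - L x y (s i)|) / 2.
  have -> : \sum_(0 <= i < n) `|L x y (s i.+1) - L x y (s i)| =
      2 / n%:R * \sum_(0 <= i < n) `|y - k i * x|.
    by rewrite mulr_sumr; apply: eq_bigr => i _; rewrite step.
  by set S := \sum_(0 <= i < n) _; field; rewrite gt_eqF.
rewrite sumE.
have [r0|r0] := leP r 0.
  have : r == 0 by rewrite eq_le r0 sqrtr_ge0.
  rewrite sqrtr_eq0 => xy0.
  have x00 : x = 0 by apply/eqP; rewrite -sqrf_eq0; have := sqr_ge0 x; have := sqr_ge0 y; lra.
  have y00 : y = 0 by apply/eqP; rewrite -sqrf_eq0; have := sqr_ge0 x; have := sqr_ge0 y; lra.
  rewrite big1 => [|i _]; last by rewrite /L x00 y00 !mul0r addr0 subrr normr0.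
  by rewrite /r x00 y00 expr0n addr0 sqrtr0 mul0r subrr normr0 mulr0.
have rr : r ^+ 2 = x ^+ 2 + y ^+ 2 by rewrite sqr_sqrtr// addr_ge0 ?sqr_ge0.
pose c := y / r.
have c1 : -1 <= c <= 1.
  rewrite -ler_norml normrM normfV ler_pdivrMr ?normr_gt0 ?gt_eqF// mul1r.
  by rewrite -ler_sqr ?nnegrE// !real_normK ?num_real// rr lerDr sqr_ge0.
have qc : q c = x / r.
  have -> : q c = Num.sqrt ((x / r) ^+ 2).
    by rewrite /q /c !expr_div_n rr; congr Num.sqrt; field; rewrite -rr gt_eqF ?exprn_gt0.
  by rewrite sqrtr_sqr ger0_norm// divr_ge0// ltW.
have Lc : L x y c = r.
  rewrite /L qc /c -[RHS]mulr1 -(divff (_ : r != 0)) ?gt_eqF// !mulrA -mulrDl.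
  by rewrite -!expr2 addrC -rr.
have mc : max_at (-1) 1 (L x y) c.
  split=> // t t1; rewrite Lc; apply: le_trans (ler_norm _) _.
  rewrite -ler_sqr ?nnegrE ?(ltW r0)// real_normK ?num_real// rr /L.
  have := sqr_ge0 (y * q t - x * t); rewrite !sqrrD sqrrN !exprMn q_sqr//; lra.
have upper : \sum_(0 <= i < n) `|L x y (s i.+1) - L x y (s i)| <= 2 * r.
  apply: (@le_trans _ _ (\sum_(0 <= i < n)
      (climb (L x y) c (s i.+1) - climb (L x y) c (s i)))).
    apply: ler_sum_nat => i /andP[_ ni].
    apply: (climb_dominates (L_concave y x0) mc).
    - by have /andP[] := s_in i (ltnW ni).
    - exact: s_mono.
    - by have /andP[] := s_in _ ni.
  rewrite telescope_sumr//.
  have /andP[c1l c1r] := c1.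
  rewrite climbr; last by rewrite sn.
  rewrite climbl; last by rewrite s0.
  rewrite L1 Lm1 Lc; lra.
have lower i : (i <= n)%N ->
    2 * L x y (s i) <= \sum_(0 <= i < n) `|L x y (s i.+1) - L x y (s i)|.
  move=> ni; rewrite (big_cat_nat (n := i))//=.
  have tri j m : (j <= m)%N -> `|L x y (s m) - L x y (s j)| <=
      \sum_(j <= i < m) `|L x y (s i.+1) - L x y (s i)|.
    by move=> jm; rewrite -(telescope_sumr (fun i => L x y (s i)) jm); exact: ler_norm_sum.
  have := tri _ _ (leq0n i); have := tri _ _ ni; rewrite L1 Lm1 !ler_norml.
  by move=> /andP[? ?] /andP[? ?]; lra.
suff [i [ni si]] : exists i, (i <= n)%N /\ r - e * x <= L x y (s i).
  by have := lower i ni; rewrite ler_norml => lo; apply/andP; split; lra.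
have q_close t : -1 <= t <= 1 -> `|c - t| <= 2 / n%:R -> q c <= q t + e.
  move=> t1 ct; have /andP[? ?] := t1; have /andP[? ?] := c1.
  rewrite -ler_sqr ?nnegrE ?addr_ge0 ?sqrtr_ge0 ?(ltW e0)//.
  rewrite sqrrD !q_sqr//.
  have : 0 <= q t * e by rewrite mulr_ge0 ?sqrtr_ge0// ltW.
  have : (t - c) * (t + c) <= e ^+ 2.
    apply: le_trans (ler_norm _) _; rewrite normrM distrC.
    apply: le_trans ne; rewrite (_ : 4 / _ = 2 / n%:R * 2); last by field; rewrite gt_eqF.
    by apply: ler_pM => //; rewrite ler_norml; apply/andP; split; lra.
  lra.
(* The grid point next to the maximizer c is taken on the side where y * s is
   not smaller than y * c. *)
have good_node i : (i <= n)%N -> y * c <= y * s i -> `|c - s i| <= 2 / n%:R ->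
    exists i, (i <= n)%N /\ r - e * x <= L x y (s i).
  move=> ni yc cs; exists i; split=> //.
  have := ler_wpM2l x0 (q_close _ (s_in _ ni) cs).
  by rewrite -[r in r - _]Lc /L; lra.
have /andP[c1l c1r] := c1.
pose i := Num.truncn ((c + 1) * n%:R / 2).
have /andP[ic ci] : s i <= c < s i.+1.
  have : 0 <= (c + 1) * n%:R / 2 by rewrite divr_ge0 ?mulr_ge0 ?(ltW n0')//; lra.
  move/truncn_itv; rewrite -/i => /andP[h1 h2]; rewrite /s; apply/andP; split.
    rewrite mulrAC -lerBrDl opprK ler_pdivrMr//; lra.
  rewrite mulrAC -ltrBlDl opprK ltr_pdivlMr//; lra.
have [ni|ni] := ltnP i n; last first.
  have si1 : s n <= s i := s_mono _ _ ni.
  have sc : s n = c by apply/eqP; rewrite eq_le {2}sn c1r (le_trans si1 ic).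
  by apply: (good_node n) => //; rewrite sc// subrr normr0 divr_ge0.
have sSi := sS i.
have [y0|y0] := leP 0 y.
  apply: (good_node i.+1) => //; first by apply: ler_wpM2l => //; exact: ltW.
  by rewrite ler0_norm; lra.
apply: (good_node i) => //; first exact: ltnW.
  by apply: ler_wnM2l => //; exact: ltW.
by rewrite ger0_norm; lra.
Qed.
End euclidean_norm_as_mean.

(** * Measurability for the one-dimensional Hausdorff measure *)

Section hausdorff_measurability.
Context {R : realType}.
Implicit Types (U A B E X : set (R * R)) (F : R * R -> R) (c d : R).

Lemma diam_ub U p q : U p -> U q -> ((enorm (p - q))%:E <= diam U)%E.
Proof. by move=> Up Uq; apply: ereal_sup_ubound; right; exists p => //; exists q. Qed.

Lemma diam_le U (r : R) : 0 <= r -> (forall p q, U p -> U q -> enorm (p - q) <= r) ->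
  (diam U <= r%:E)%E.
Proof.
move=> r0 Ur; apply: ge_ereal_sup => _ [->|[p Up [q Uq <-]]]; first by rewrite lee_fin.
by rewrite lee_fin Ur.
Qed.

Lemma le_diam A B : A `<=` B -> (diam A <= diam B)%E.
Proof.
move=> AB; apply: ge_ereal_sup => _ [->|[p Ap [q Aq <-]]]; first exact: diam_ge0.
by apply: diam_ub; exact: AB.
Qed.

Lemma hausdorff1_delta_antitone A (d1 d2 : R) : d1 <= d2 ->
  (hausdorff1_delta d2 A <= hausdorff1_delta d1 A)%E.
Proof.
move=> d12; apply: ereal_inf_le_tmp => _ [U [dU AU] <-]; exists U => //.
by split=> // k; rewrite (le_trans (dU k))// lee_fin.
Qed.

Lemma hausdorff1_delta_le A d : 0 < d -> (hausdorff1_delta d A <= hausdorff1 A)%E.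
Proof. by move=> d0; apply: ereal_sup_ubound; exists d. Qed.

Definition lipschitz1 F := forall p q, `|F p - F q| <= enorm (p - q).

(** A set of diameter at most [delta] cannot meet both [A] and [B], so that a
    cover of the union splits into a cover of [A] and a cover of [B]. *)
Lemma hausdorff1_delta_separated F A B c d delta : lipschitz1 F -> delta < d - c ->
  (forall z, A z -> F z <= c) -> (forall z, B z -> d <= F z) ->
  (hausdorff1_delta delta A + hausdorff1_delta delta B <=
   hausdorff1_delta delta (A `|` B))%E.
Proof.
move=> lF dcd Ac Bd; apply: le_ereal_inf_tmp => _ [U [dU ABU] <-].
apply: (@le_trans _ _ (\sum_(0 <= k <oo) diam (U k `&` A) +
                       \sum_(0 <= k <oo) diam (U k `&` B))%E).
  apply: leeD; apply: ereal_inf_lbound.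
    exists (fun k => U k `&` A) => //; split=> [k|z Az].
      by apply: le_trans (dU k); apply: le_diam; exact: subIsetl.
    by have [k _ Uk] := ABU z (or_introl Az); exists k.
  exists (fun k => U k `&` B) => //; split=> [k|z Bz].
    by apply: le_trans (dU k); apply: le_diam; exact: subIsetl.
  by have [k _ Uk] := ABU z (or_intror Bz); exists k.
rewrite -nneseriesD; [|by move=> *; exact: diam_ge0..].
apply: lee_nneseries => [k _ _|k _]; first by rewrite adde_ge0// diam_ge0.
have [[p [Up Ap]]|nA] := pselect (U k `&` A !=set0).
  have [[q [Uq Bq]]|nB] := pselect (U k `&` B !=set0).
    have := le_trans (diam_ub Uq Up) (dU k).
    rewrite lee_fin leNgt => /negP[]; apply: lt_le_trans dcd _.
    apply: le_trans (lF q p); apply: le_trans (ler_norm _).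
    by have := Ac _ Ap; have := Bd _ Bq; lra.
  have -> : U k `&` B = set0 by apply/eqP/negPn/negP => /set0P.
  by rewrite diam0 adde0; apply: le_diam; exact: subIsetl.
have -> : U k `&` A = set0 by apply/eqP/negPn/negP => /set0P.
by rewrite diam0 add0e; apply: le_diam; exact: subIsetl.
Qed.

Lemma hausdorff1_separated F A B c d : lipschitz1 F -> c < d ->
  (forall z, A z -> F z <= c) -> (forall z, B z -> d <= F z) ->
  (hausdorff1 A + hausdorff1 B <= hausdorff1 (A `|` B))%E.
Proof.
move=> lF cd Ac Bd; have [->|fin] := eqVneq (hausdorff1 (A `|` B)) +oo%E.
  by rewrite leey.
have finS (C : set (R * R)) : C `<=` A `|` B -> hausdorff1 C \is a fin_num.
  move=> CAB; rewrite ge0_fin_numE ?hausdorff1_ge0//.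
  by apply: le_lt_trans (le_hausdorff1 CAB) _; rewrite ltey.
have fA := finS _ (@subsetUl _ A B); have fB := finS _ (@subsetUr _ A B).
have ffin C (e : R) : 0 < e -> hausdorff1 C \is a fin_num -> hausdorff1_delta e C \is a fin_num.
  move=> e0; rewrite !ge0_fin_numE ?hausdorff1_ge0 ?hausdorff1_delta_ge0//.
  by move=> fC; exact: le_lt_trans (hausdorff1_delta_le C e0) fC.
rewrite -leeBrDr//; apply: ge_ereal_sup => _ [e1 /= e10 <-].
rewrite leeBrDr// addeC -leeBrDr ?ffin//; apply: ge_ereal_sup => _ [e2 /= e20 <-].
rewrite leeBrDr ?ffin// addeC.
pose e := Num.min (Num.min e1 e2) ((d - c) / 2).
have e0 : 0 < e by rewrite /e !lt_min e10 e20/=; lra.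
have edc : e < d - c by rewrite /e gt_min; apply/orP; right; lra.
apply: (@le_trans _ _ (hausdorff1_delta e A + hausdorff1_delta e B)%E).
  apply: leeD; apply: hausdorff1_delta_antitone; rewrite /e.
    by rewrite !ge_min lexx.
  by rewrite !ge_min lexx orbT.
apply: le_trans (hausdorff1_delta_separated lF edc Ac Bd) _.
exact: hausdorff1_delta_le.
Qed.

(** The criterion of Caratheodory for metric outer measures.  The part of [X]
    above the level [c] is exhausted by the sets [B n] at positive distance from
    the sublevel set.  What is left beyond [B n] is covered by strips, and since
    every other strip is separated from the previous ones, their measures have a
    finite sum. *)
Lemma lipschitz1_caratheodory F c : lipschitz1 F ->
  (@hausdorff1 R).-caratheodory [set z | F z <= c].
Proof.
move=> lF; apply: (@le_caratheodory_measurable _ _ (@hausdorff1 R)) => X /=.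
set A := [set z | F z <= c].
have [->|fin] := eqVneq (hausdorff1 X) +oo%E; first by rewrite leey.
have finS (C : set (R * R)) : C `<=` X -> hausdorff1 C \is a fin_num.
  move=> CX; rewrite ge0_fin_numE ?hausdorff1_ge0//.
  by apply: le_lt_trans (le_hausdorff1 CX) _; rewrite ltey.
pose h n : R := c + n.+1%:R^-1.
have h_anti n m : (n <= m)%N -> h m <= h n.
  by move=> nm; rewrite lerD2l lef_pV2 ?posrE// ler_nat.
have h_lt n : h n.+1 < h n by rewrite ltrD2l ltf_pV2 ?posrE// ltr_nat.
pose B n := X `&` [set z | h n <= F z].
pose S n := X `&` [set z | h n.+2 <= F z <= h n.+1].
have aS n : (hausdorff1 (B n) + hausdorff1 (S n) <= hausdorff1 (B n.+2))%E.
  rewrite addeC; apply: le_trans (hausdorff1_separated lF (h_lt n) _ _) _.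
  - by move=> z [_ /andP[]].
  - by move=> z [].
  - apply: le_hausdorff1 => z [[Xz /= /andP[]]|[Xz /=]] //.
    by move=> hF; split=> //=; apply: le_trans hF; apply: h_anti; rewrite -addn2 leq_addr.
have S_sum : (\sum_(0 <= k <oo) hausdorff1 (S k) < +oo)%E.
  have fX : (hausdorff1 X + hausdorff1 X < +oo)%E.
    by rewrite ltey_eq; apply/orP; left; rewrite fin_numD finS.
  apply: le_lt_trans fX; apply: lime_le.
    by apply: is_cvg_nneseries => *; exact: hausdorff1_ge0.
  apply: nearW => n.
  apply: (@le_trans _ _ (hausdorff1 (B n) + hausdorff1 (B n.+1))%E); last first.
    by apply: leeD; apply: le_hausdorff1; exact: subIsetl.
  elim: n => [|n IH]; first by rewrite big_geq// adde_ge0// hausdorff1_ge0.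
  rewrite big_nat_recr//=; apply: le_trans (leeD IH (lexx _)) _.
  by rewrite addeAC addeC; apply: leeD => //; exact: aS.
have tail n : (hausdorff1 (X `&` ~` A) <=
    hausdorff1 (B n.+1) + \sum_(n <= k <oo) hausdorff1 (S k))%E.
  apply: (@le_trans _ _ (hausdorff1 (B n.+1) +
      hausdorff1 (\bigcup_(k in ~` `I_n) S k))%E); last first.
    apply: leeD => //.
    exact: (outer_measure_sigma_subadditive_tail (@hausdorff1 R)).
  apply: le_trans (outer_measureU2 (@hausdorff1 R) _ _).
  apply: le_hausdorff1 => z [Xz /= /negP]; rewrite -ltNge => cz.
  have [hz|zh] := leP (h n.+1) (F z); first by left.
  have exm : exists m, h m <= F z.
    exists (Num.truncn (F z - c)^-1); rewrite /h -lerBrDl -[leRHS]invrK.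
    by rewrite lef_pV2 ?posrE ?invr_gt0 ?subr_gt0// ltW// truncnS_gt.
  have [m hm min_m] := ex_minnP exm.
  have nm : (n.+1 < m)%N.
    by rewrite ltnNge; apply/negP => /h_anti/le_trans/(_ hm); rewrite leNgt zh.
  case: m nm hm min_m => [//|[//|k]] nk hk min_k; right.
  exists k; first by rewrite /= ltnNge; apply/negP; rewrite negbK -ltnS.
  split=> //=; rewrite hk/= leNgt; apply/negP => /ltW/min_k.
  by rewrite ltnn.
have sep n : (hausdorff1 (X `&` A) + hausdorff1 (B n) <= hausdorff1 X)%E.
  apply: le_trans (@hausdorff1_separated F _ _ c (h n) lF _ _ _) _.
  - by rewrite ltrDl invr_gt0.
  - by move=> z [].
  - by move=> z [].
  - by apply: le_hausdorff1 => z [[]|[]].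
have lim : (hausdorff1 X + \sum_(n <= k <oo) hausdorff1 (S k) @[n --> \oo] -->
    hausdorff1 X + 0)%E.
  apply: cvgeD => //; first by rewrite fin_num_adde_defl.
    exact: cvg_cst.
  by apply: nneseries_tail_cvg => // k _; exact: hausdorff1_ge0.
rewrite -[leRHS]adde0 -(cvg_lim _ lim)//; apply: lime_ge.
  by apply/cvg_ex; exists (hausdorff1 X + 0)%E.
apply: nearW => n; apply: le_trans (leeD (lexx _) (tail n)) _.
by rewrite addeA; apply: leeD.
Qed.

End hausdorff_measurability.

(** * Bounds on the one-dimensional Hausdorff measure *)

Section hausdorff_bounds.
Context {R : realType}.
Implicit Types (U E : set (R * R)) (F : R * R -> R).

Lemma lipschitz1_image_length F U (r : R) : lipschitz1 F -> (diam U <= r%:E)%E ->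
  exists I : set R, [/\ measurable I, F @` U `<=` I & (lebesgue_measure I <= diam U)%E].
Proof.
move=> lF Ur; have [[z0 Uz0]|nU] := pselect (U !=set0); last first.
  exists set0; split=> //; last by rewrite measure0 diam_ge0.
  by move=> x [z Uz _]; apply: nU; exists z.
have fU : diam U \is a fin_num.
  by rewrite ge0_fin_numE ?diam_ge0// (le_lt_trans Ur)// ltry.
pose D := fine (diam U).
have FD (x y : R) : (F @` U) x -> (F @` U) y -> x <= y + D.
  move=> [p Up <-] [q Uq <-]; rewrite -lerBlDl.
  apply: le_trans (ler_norm _) _; apply: le_trans (lF p q) _.
  by rewrite -lee_fin fineK//; exact: diam_ub.
have F0 : F @` U !=set0 by exists (F z0); exists z0.
have ubF : has_ubound (F @` U).
  by exists (F z0 + D) => x Ux; apply: FD => //; exists z0.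
have lbF : has_lbound (F @` U).
  by exists (F z0 - D) => x Ux; rewrite lerBlDr; apply: FD => //; exists z0.
exists `[inf (F @` U), sup (F @` U)]%classic; split=> //.
  move=> x Ux; rewrite /= in_itv/=; apply/andP; split.
    exact: ge_inf.
  exact: ub_le_sup.
rewrite lebesgue_measure_itv/= lte_fin; case: ifPn => [_|_]; last exact: diam_ge0.
rewrite -(fineK fU) -EFinB lee_fin -/D lerBlDr addrC.
apply: ge_sup => // x Ux; rewrite -lerBlDr; apply: lb_le_inf => // y Uy.
by rewrite lerBlDr; exact: FD.
Qed.

(** A 1-Lipschitz map sends a cover of [E] to a cover of the interval by sets
    of no larger diameter. *)
Lemma hausdorff1_ge_projection F E (p q : R) : lipschitz1 F -> p <= q ->
  (forall t, p < t < q -> exists2 z, E z & F z = t) ->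
  ((q - p)%:E <= hausdorff1 E)%E.
Proof.
move=> lF pq pE; apply: le_trans (@hausdorff1_delta_le _ E 1 ltr01).
apply: le_ereal_inf_tmp => _ [U [dU EU] <-].
pose I k := sval (cid (lipschitz1_image_length lF (dU k))).
have IP k : [/\ measurable (I k), F @` U k `<=` I k &
    (lebesgue_measure (I k) <= diam (U k))%E].
  exact: svalP (cid (lipschitz1_image_length lF (dU k))).
have -> : (q - p)%:E = lebesgue_measure `]p, q[%classic.
  rewrite lebesgue_measure_itv/= lte_fin; case: ltP => //.
  by move=> qp; rewrite (_ : p = q) ?subrr//; apply/eqP; rewrite eq_le pq.
apply: (@le_trans _ _ (\sum_(0 <= k <oo) lebesgue_measure (I k))%E).
  apply: measure_sigma_subadditive => //.
  - by move=> k; have [] := IP k.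
  - move=> t /=; rewrite in_itv/= => /pE[z Ez <-]; have [k _ Uk] := EU z Ez.
    by exists k => //; have [_ + _] := IP k; apply; exists z.
by apply: lee_nneseries => // k _; have [] := IP k.
Qed.

(** Cutting the range of [w] into short intervals of equal length cuts [g @` S]
    into pieces whose diameters are at most that length.  Neither [g] nor [w]
    needs to be continuous for this. *)
Lemma hausdorff1_le_image (g : R -> R * R) (S : set R) (w : R -> R) (lo hi : R) :
  lo <= hi -> (forall u, S u -> lo <= w u <= hi) ->
  (forall u v, S u -> S v -> enorm (g u - g v) <= `|w u - w v|) ->
  (hausdorff1 (g @` S) <= (hi - lo)%:E)%E.
Proof.
move=> lohi Sw gw; apply/lee_addgt0Pr => e e0.
(* The slack e makes the last of the half-open pieces contain the level hi. *)
rewrite -EFinD; set L := (hi - lo + e)%R.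
have L0 : 0 < L by rewrite /L; lra.
apply: ge_ereal_sup => _ [d /= d0 <-].
pose N := (Num.truncn (L / d)).+1.
have N0 : 0 < N%:R :> R by rewrite ltr0n.
pose h := L / N%:R.
have h0 : 0 < h by rewrite divr_gt0.
have hd : h <= d.
  by rewrite ler_pdivrMr// mulrC -ler_pdivrMr// ltW// truncnS_gt.
pose P k := [set u | S u /\ lo + k%:R * h <= w u < lo + k.+1%:R * h].
pose U k := if (k < N)%N then g @` P k else set0.
have dU k : (k < N)%N -> (diam (U k) <= h%:E)%E.
  move=> kN; rewrite /U kN; apply: diam_le; first exact: ltW.
  move=> _ _ [u [Su /andP[u1 u2]] <-] [v [Sv /andP[v1 v2]] <-].
  apply: le_trans (gw _ _ Su Sv) _; rewrite -natr1 mulrDl mul1r in u2 v2.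
  by rewrite ler_norml; apply/andP; split; lra.
have dU0 k : (N <= k)%N -> diam (U k) = 0%E.
  by move=> Nk; rewrite /U ltnNge Nk/= diam0.
apply: (@le_trans _ _ (\sum_(0 <= k <oo) diam (U k))%E).
  apply: ereal_inf_lbound; exists U => //; split=> [k|_ [u Su <-]].
    have [kN|Nk] := ltnP k N; first by rewrite (le_trans (dU _ kN))// lee_fin.
    by rewrite dU0// lee_fin ltW.
  have wu0 : 0 <= (w u - lo) / h by rewrite divr_ge0 ?(ltW h0)// subr_ge0; have /andP[] := Sw _ Su.
  have /andP[k1 k2] := truncn_itv wu0; set k := Num.truncn _ in k1 k2.
  exists k => //.
  have kN : (k < N)%N.
    rewrite -(ltr_nat R); apply: le_lt_trans k1 _; rewrite ltr_pdivrMr// /h mulrC divfK ?gt_eqF//.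
    by have /andP[_ ?] := Sw _ Su; rewrite /L; lra.
  rewrite /U kN; exists u => //; split=> //.
  rewrite -lerBrDl -ler_pdivlMr// k1/= -ltrBlDl.
  by rewrite -ltr_pdivrMr.
rewrite (@nneseries_split _ _ 0 N); last by move=> *; exact: diam_ge0.
rewrite [X in (_ + X)%E]eseries0; last by move=> k Nk _; exact: dU0.
rewrite adde0 add0n.
apply: (@le_trans _ _ (\sum_(0 <= k < N) h%:E)%E).
  rewrite big_nat [leRHS]big_nat; apply: lee_sum => k /andP[_ kN]; exact: dU.
rewrite sumEFin lee_fin sumr_const_nat subn0 -[h *+ N]mulr_natr.
by rewrite /h divfK ?gt_eqF.
Qed.

End hausdorff_bounds.

(** * Rotation invariance of the area *)

Section area_rotation.
Context {R : realType}.
Local Notation mu := (@lebesgue_measure R).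
Local Notation RR := (measurableTypeR R).
Local Notation T := (RR * RR)%type.

Lemma lebesgue_measure_translation (c : R) (A : set RR) : measurable A ->
  mu ((fun y => y + c) @^-1` A) = mu A.
Proof.
move=> mA; have mt : measurable_fun [set: RR] (fun y : RR => y + c : RR).
  exact: measurable_funD.
apply/esym/(@lebesgue_measure_unique _
  (pushforward mu (fun y : RR => y + c : RR))) => // X.
move=> /ocitvP[->|[[a b] /= ab ->]]; first by rewrite !measure0.
rewrite /= /pushforward (_ : _ @^-1` _ = `]a - c, b - c]%classic).
  rewrite !lebesgue_measure_itv/= !lte_fin ab ltrD2r ab -!EFinB; congr (_%:E); ring.
by apply/seteqP; split => y /=; rewrite !in_itv/= ltrBlDr lerBrDr.
Qed.

Local Open Scope ereal_scope.

Lemma integral_translation (c : R) (f : RR -> \bar R) :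
  measurable_fun [set: RR] f -> (forall y, 0 <= f y) ->
  \int[mu]_y f (y + c)%R = \int[mu]_y f y.
Proof.
move=> mf f0; have mt : measurable_fun [set: RR] (fun y : RR => (y + c)%R : RR).
  exact: measurable_funD.
rewrite -[LHS](@ge0_integral_pushforward _ _ _ _ _ _ mt mu setT f)//.
by apply: eq_measure_integral => A mA _; exact: lebesgue_measure_translation.
Qed.

Lemma integral_vshear (b : R) (f : T -> \bar R) :
  measurable_fun [set: T] f -> (forall z, 0 <= f z) ->
  \int[area]_z f (z.1, z.2 + b * z.1)%R = \int[area]_z f z.
Proof.
move=> mf f0.
have mS : measurable_fun [set: T] (fun z : T => (z.1, (z.2 + b * z.1)%R) : T).
  apply: measurable_fun_pair => //.
  by apply: measurable_funD => //; apply: measurable_funM.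
rewrite /area fubini_tonelli1 ?fubini_tonelli1//; last first.
  exact: measurableT_comp mf mS.
apply: eq_integral => x _; rewrite /fubini_F/=.
rewrite (integral_translation (b * x) (f := fun y => f (x, y)))//.
exact: measurable_fun_pair2.
Qed.

Lemma integral_hshear (b : R) (f : T -> \bar R) :
  measurable_fun [set: T] f -> (forall z, 0 <= f z) ->
  \int[area]_z f (z.1 + b * z.2, z.2)%R = \int[area]_z f z.
Proof.
move=> mf f0.
have mS : measurable_fun [set: T] (fun z : T => ((z.1 + b * z.2)%R, z.2) : T).
  apply: measurable_fun_pair => //.
  by apply: measurable_funD => //; apply: measurable_funM.
rewrite /area fubini_tonelli2 ?fubini_tonelli2//; last first.
  exact: measurableT_comp mf mS.
apply: eq_integral => y _; rewrite /fubini_G/=.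
rewrite (integral_translation (b * y) (f := fun x => f (x, y)))//.
exact: measurable_fun_pair1.
Qed.

Definition rot (c s : R) (z : R * R) : R * R :=
  (c * z.1 - s * z.2, s * z.1 + c * z.2)%R.

Lemma measurable_rot (c s : R) : measurable_fun [set: T] (rot c s : T -> T).
Proof.
by apply: measurable_fun_pair; [apply: measurable_funB|apply: measurable_funD];
  apply: measurable_funM.
Qed.

(** A rotation with nonzero sine is a product of three shears, and shears
    preserve area by Fubini and translation invariance of lengths. *)
Let integral_rot_sin_neq0 (c s : R) (f : T -> \bar R) :
  (c ^+ 2 + s ^+ 2 = 1)%R -> s != 0%R ->
  measurable_fun [set: T] f -> (forall z, 0 <= f z) ->
  \int[area]_z f (rot c s z) = \int[area]_z f z.
Proof.
move=> cs s0 mf f0; pose a := ((c - 1) / s)%R.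
have mh : measurable_fun [set: T] (fun z : T => ((z.1 + a * z.2)%R, z.2) : T).
  apply: measurable_fun_pair => //.
  by apply: measurable_funD => //; apply: measurable_funM.
have mv : measurable_fun [set: T] (fun z : T => (z.1, (z.2 + s * z.1)%R) : T).
  apply: measurable_fun_pair => //.
  by apply: measurable_funD => //; apply: measurable_funM.
rewrite -(integral_hshear a mf)//.
rewrite -(integral_vshear s (f := fun z => f (z.1 + a * z.2, z.2)%R))//; last first.
  exact: measurableT_comp mf mh.
rewrite -(integral_hshear a (f := fun z => f (z.1 + a * (z.2 + s * z.1), (z.2 + s * z.1))%R))//; last first.
  exact: measurableT_comp (measurableT_comp mf mh) mv.
have as1 : (a * s = c - 1)%R by rewrite /a divfK.
have ac : (a * (1 + c) = - s)%R.
  by apply: (mulIf s0); rewrite mulrAC as1 mulNr -expr2; lra.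
apply: eq_integral => z _; congr (f _); rewrite /rot/=; congr pair.
  rewrite (_ : (_ + a * (_ + _) = (1 + a * s) * z.1 + a * (2 + a * s) * z.2)%R); last by ring.
  by rewrite as1 (_ : (2 + (c - 1) = 1 + c)%R) ?ac; ring.
rewrite (_ : (_ + s * (_ + _) = s * z.1 + (1 + a * s) * z.2)%R); last by ring.
by rewrite as1; ring.
Qed.

Lemma integral_rot (c s : R) (f : T -> \bar R) : (c ^+ 2 + s ^+ 2 = 1)%R ->
  measurable_fun [set: T] f -> (forall z, 0 <= f z) ->
  \int[area]_z f (rot c s z) = \int[area]_z f z.
Proof.
move=> cs mf f0; have [s0|] := eqVneq s 0%R; last by move=> s0; exact: integral_rot_sin_neq0.
have c1 : ((c - 1) * (c + 1) = 0)%R by move: cs; rewrite s0; lra.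
move/eqP: c1; rewrite mulf_eq0 subr_eq0 addr_eq0 => /orP[]/eqP->.
  by apply: eq_integral => z _; congr (f _); case: z => x y; rewrite /rot s0/=; congr pair; ring.
(* The remaining case is the half turn, the square of a quarter turn. *)
have q : (0 ^+ 2 + 1 ^+ 2 = 1 :> R)%R by ring.
rewrite -(integral_rot_sin_neq0 q _ mf)// -(integral_rot_sin_neq0 q (f := fun z => f (rot 0 1 z)))//.
  by apply: eq_integral => z _; congr (f _); rewrite /rot s0/=; congr pair; ring.
exact: measurableT_comp mf (measurable_rot 0 1).
Qed.

End area_rotation.

(** * The upper boundary of a convex body *)

Section top_function.
Context {R : realType}.
Implicit Types (p q z u theta eta : R * R) (Omega : set (R * R)).

Lemma dot_continuous u : continuous (fun z => dot z u).
Proof.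
move=> z; rewrite /dot; apply: cvgD; apply: cvgM; try exact: cvg_cst.
  exact: cvg_fst.
exact: cvg_snd.
Qed.

Lemma dotC p q : dot p q = dot q p.
Proof. by rewrite /dot [p.1 * _]mulrC [p.2 * _]mulrC. Qed.

Lemma dotDl p q u : dot (p + q) u = dot p u + dot q u.
Proof. by rewrite /dot/=; ring. Qed.

Lemma dotBl p q u : dot (p - q) u = dot p u - dot q u.
Proof. by rewrite /dot/=; ring. Qed.

Lemma dotZl (k : R) p u : dot (k *: p) u = k * dot p u.
Proof. by rewrite /dot /GRing.scale/= /GRing.scale/=; ring. Qed.

Lemma dotNr p u : dot p (- u) = - dot p u.
Proof. by rewrite /dot/=; ring. Qed.

Lemma convexP Omega p q (k : R) : convex_set Omega -> 0 <= k <= 1 ->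
  Omega p -> Omega q -> Omega (k *: p + (1 - k) *: q).
Proof.
move=> cO k01 Op Oq.
have kP : Itv.spec (@Itv.num_sem R) (Itv.Real `[0%Z, 1%Z]) k.
  by rewrite /Itv.num_sem/= num_real in_itv/= k01.
have := cO p q (Itv.mk kP); rewrite !inE; apply => //.
Qed.

Definition clamp (a b t : R) : R := Num.max a (Num.min b t).

Lemma clamp_in a b t : a <= b -> a <= clamp a b t <= b.
Proof. by move=> ab; rewrite /clamp le_max lexx/= ge_max ab ge_min lexx. Qed.

Lemma clamp_id a b t : a <= t <= b -> clamp a b t = t.
Proof. by move=> /andP[at_ tb]; rewrite /clamp min_r// max_r. Qed.

Lemma clamp_le a b s t : `|clamp a b s - clamp a b t| <= `|s - t|.
Proof.
rewrite ler_norml /clamp; have := ler_norm (s - t); have := ler_norm (- (s - t)).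
rewrite normrN; move: `|s - t| => e h1 h2; rewrite !maxEle !minEle.
by apply/andP; split; repeat case: ifPn => //; rewrite -?ltNge; lra.
Qed.

Variables (Omega : set (R * R)) (theta eta : R * R) (a b : R).
Hypothesis cptO : compact Omega.
Hypothesis cvxO : convex_set Omega.
Hypothesis ab : a < b.
Hypothesis rangeO : [set dot z theta | z in Omega] = `[a, b]%classic.

(** [clamp] extends the function constantly outside [[a, b]], which makes it
    continuous on the whole line. *)
Definition top t : R :=
  sup [set dot z eta | z in [set z | Omega z /\ dot z theta = clamp a b t]].

Lemma top_max t : a <= t <= b -> exists z, [/\ Omega z, dot z theta = t,
  dot z eta = top t & forall z', Omega z' -> dot z' theta = t -> dot z' eta <= top t].
Proof.
move=> tab; rewrite /top clamp_id//.
set S := [set z | _ /\ _].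
have S0 : S !=set0.
  have : `[a, b]%classic t by rewrite /= in_itv.
  by rewrite -rangeO => -[z Oz zt]; exists z.
have cS : compact S.
  rewrite (_ : S = Omega `&` (fun z => dot z theta) @^-1` [set t]) //.
  apply: compact_closedI => //; apply: closed_comp; last exact: closed_eq.
  by move=> z _; exact: dot_continuous.
have [z + zmax] := @compact_EVT_max _ R (fun z => dot z eta) _ S0 cS
  (continuous_subspaceT (@dot_continuous eta)).
rewrite inE => -[Oz zt].
have supE : sup [set dot z eta | z in S] = dot z eta.
  apply/eqP; rewrite eq_le; apply/andP; split.
    apply: ge_sup; first by exists (dot z eta); exists z.
    by move=> _ [z' Sz' <-]; apply: zmax; rewrite inE.
  apply: ub_le_sup; last by exists z.
  by exists (dot z eta) => _ [z' Sz' <-]; apply: zmax; rewrite inE.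
exists z; split=> // z' Oz' z't; rewrite supE.
by apply: zmax; rewrite inE.
Qed.

Lemma range_in z : Omega z -> a <= dot z theta <= b.
Proof.
by move=> Oz; have : [set dot z theta | z in Omega] (dot z theta) by [exists z];
  rewrite rangeO /= in_itv.
Qed.

Lemma le_top z : Omega z -> dot z eta <= top (dot z theta).
Proof. by move=> Oz; have [_ [_ _ _]] := top_max (range_in Oz); apply. Qed.

Lemma top_concave : concave_on a b top.
Proof.
move=> u v w au uv vw wb.
move: (uv); rewrite le_eqVlt => /predU1P[->|uv']; first lra.
have [p [Op pu pt _]] : exists z, [/\ Omega z, dot z theta = u, dot z eta = top u & True].
  by have [|z [? ? ? _]] := @top_max u; [apply/andP; split; lra|exists z].
have [q [Oq qw qt _]] : exists z, [/\ Omega z, dot z theta = w, dot z eta = top w & True].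
  by have [|z [? ? ? _]] := @top_max w; [apply/andP; split; lra|exists z].
pose k := (w - v) / (w - u).
have wu : 0 < w - u by lra.
have kE : k * (w - u) = w - v by rewrite /k divfK// gt_eqF.
have k01 : 0 <= k <= 1.
  by rewrite /k; apply/andP; split; [rewrite divr_ge0//; lra|rewrite ler_pdivrMr//; lra].
have Oz := convexP cvxO k01 Op Oq.
have := le_top Oz; rewrite !dotDl !dotZl pu qw pt qt.
rewrite (_ : k * u + (1 - k) * w = v); last by lra.
move=> /(ler_wpM2l (ltW wu)); rewrite -kE (_ : v - u = (1 - k) * (w - u)); first lra.
by rewrite mulrBl kE mul1r; lra.
Qed.

Lemma topE t : top t = top (clamp a b t).
Proof. by rewrite /top (clamp_id (clamp_in t (ltW ab))). Qed.

Let top_bounded : exists M, 0 < M /\ forall t, a <= t <= b -> `|top t| <= M.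
Proof.
have [M [_ bM]] := @compact_bounded _ _ _ (continuous_compact
  (continuous_subspaceT (@dot_continuous eta)) cptO).
exists (`|M| + 1); split; first by rewrite ltr_wpDl.
move=> t /top_max[z [Oz _ <- _]]; apply: bM; last by exists z.
by rewrite (le_lt_trans (ler_norm _))// ltrDl.
Qed.

(** The points of the body at height at least [top t + e] form a compact set;
    its projection is closed and does not contain [t]. *)
Let top_usc t e : a <= t <= b -> 0 < e -> exists2 d, 0 < d &
  forall x, a <= x <= b -> `|x - t| < d -> top x < top t + e.
Proof.
move=> tab e0.
pose K := Omega `&` (fun z => dot z eta) @^-1` [set y | top t + e <= y].
have cK : compact K.
  apply: compact_closedI => //; apply: closed_comp; last exact: closed_ge.
  by move=> z _; exact: dot_continuous.
have clK : closed [set dot z theta | z in K].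
  apply: compact_closed; first exact: Rhausdorff.
  exact: continuous_compact (continuous_subspaceT (@dot_continuous theta)) cK.
have : (~` [set dot z theta | z in K]) t.
  move=> [z [Oz /= zt] zt']; have := le_top Oz; rewrite zt'.
  by move: zt; lra.
move: clK; rewrite -openC => /[swap] tK /(_ _ tK)/nbhs_ballP[d d0 dK].
exists d => // x xab xt; rewrite ltNge; apply/negP => tx.
have [z [Oz zx zt _]] := top_max xab.
apply: (dK x); first by rewrite /ball/= distrC.
by exists z => //; split=> //=; rewrite zt.
Qed.

(** Concavity bounds [top] from below by the chord from [t] to the end of the
    segment on the side of [x]. *)
Let top_lsc t e : a <= t <= b -> 0 < e -> exists2 d, 0 < d &
  forall x, a <= x <= b -> `|x - t| < d -> top t - e < top x.
Proof.
move=> /andP[at_ tb] e0; have [M [M0 bM]] := top_bounded.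
have bnd x : a <= x <= b -> - M <= top x <= M by move=> /bM; rewrite ler_norml.
pose D := Num.min (if t < b then b - t else 1) (if a < t then t - a else 1).
have D0 : 0 < D.
  by rewrite /D lt_min; apply/andP; split; case: ifPn => //; rewrite subr_gt0.
exists (D * e / (2 * M + 1)); first by rewrite divr_gt0 ?mulr_gt0//; lra.
move=> x /andP[ax xb]; rewrite ltr_pdivlMr; last by lra.
have := bnd t; rewrite at_ tb => /(_ isT)/andP[t1 t2] xt.
have aux s : 0 < s -> D <= s -> s * top t - `|x - t| * (2 * M) <= s * top x ->
    top t - e < top x.
  move=> s0 Ds h; rewrite -(ltr_pM2l s0); apply: lt_le_trans h.
  rewrite mulrBr ltrD2l ltrN2.
  have : D * e <= s * e by rewrite ler_pM2r.
  by have := normr_ge0 (x - t); lra.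
have [xt'|tx] := leP x t.
  move: xt'; rewrite le_eqVlt => /predU1P[->|xt']; first lra.
  have tab : a < t by lra.
  apply: (aux (t - a)); [lra|by rewrite /D tab ge_min lexx orbT|].
  have := top_concave (lexx a) ax (ltW xt') tb.
  have := bnd a; rewrite lexx (ltW ab) => /(_ isT)/andP[a1 a2].
  rewrite ltr0_norm ?subr_lt0//.
  have : (t - x) * (- M) <= (t - x) * top a by rewrite ler_pM2l// subr_gt0.
  have : (t - x) * top t <= (t - x) * M by rewrite ler_pM2l// subr_gt0.
  lra.
have tab : t < b by lra.
apply: (aux (b - t)); [lra|by rewrite /D tab ge_min lexx|].
have := top_concave at_ (ltW tx) xb (lexx b).
have := bnd b; rewrite lexx (ltW ab) => /(_ isT)/andP[a1 a2].
rewrite gtr0_norm ?subr_gt0//.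
have : (x - t) * (- M) <= (x - t) * top b by rewrite ler_pM2l// subr_gt0.
have : (x - t) * top t <= (x - t) * M by rewrite ler_pM2l// subr_gt0.
lra.
Qed.

Lemma top_continuous : continuous top.
Proof.
move=> t; apply/cvgrPdist_lt => e e0.
have tab := clamp_in t (ltW ab).
have [d1 d10 h1] := top_usc tab e0; have [d2 d20 h2] := top_lsc tab e0.
near=> x; rewrite (topE t) (topE x).
have xab := clamp_in x (ltW ab).
have xt1 : `|t - x| < d1 by near: x; apply/nbhs_ballP; exists d1.
have xt2 : `|t - x| < d2 by near: x; apply/nbhs_ballP; exists d2.
have cxt := clamp_le a b x t; rewrite distrC in cxt.
have h1' := h1 _ xab; have h2' := h2 _ xab.
rewrite distrC in cxt; rewrite [in leRHS]distrC in cxt.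
have := h1' (le_lt_trans cxt xt1); have := h2' (le_lt_trans cxt xt2).
by rewrite ltr_norml => ? ?; apply/andP; split; lra.
Unshelve. all: by end_near. Qed.

End top_function.

(** * Length of the graph of a concave function *)

Section frame.
Context {R : realType}.
Implicit Types (p q z u w : R * R).

Lemma enorm_ge0 p : 0 <= enorm p.
Proof. exact: sqrtr_ge0. Qed.

Lemma enorm_sqr p : enorm p ^+ 2 = dot p p.
Proof. by rewrite sqr_sqrtr// /dot -!expr2 addr_ge0 ?sqr_ge0. Qed.

Lemma enormC p q : enorm (p - q) = enorm (q - p).
Proof. by rewrite /enorm /dot/=; congr Num.sqrt; ring. Qed.

Lemma dot_le_enorm p w : enorm w = 1 -> `|dot p w| <= enorm p.
Proof.
move=> w1; rewrite -ler_sqr ?nnegrE ?enorm_ge0// real_normK ?num_real//.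
have : dot w w = 1 by rewrite -enorm_sqr w1 expr1n.
rewrite enorm_sqr /dot => ww.
have := sqr_ge0 (p.1 * w.2 - p.2 * w.1) => h.
have -> : p.1 * p.1 + p.2 * p.2 = (p.1 * p.1 + p.2 * p.2) * (w.1 * w.1 + w.2 * w.2).
  by rewrite ww mulr1.
lra.
Qed.

Lemma dot_lipschitz1 w : enorm w = 1 -> lipschitz1 (fun z => dot z w).
Proof. by move=> w1 p q; rewrite -dotBl; exact: dot_le_enorm. Qed.

Variables (c s : R).
Hypothesis cs1 : c ^+ 2 + s ^+ 2 = 1.

Lemma rot_dot1 p : dot (rot c s p) (c, s) = p.1.
Proof. by rewrite /dot/=; rewrite -[RHS]mul1r -cs1; ring. Qed.

Lemma rot_dot2 p : dot (rot c s p) (- s, c) = p.2.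
Proof. by rewrite /dot/=; rewrite -[RHS]mul1r -cs1; ring. Qed.

Lemma rot_coords z : rot c s (dot z (c, s), dot z (- s, c)) = z.
Proof.
case: z => x y; rewrite /rot /dot/=; congr pair.
  by rewrite -[RHS]mul1r -cs1; ring.
by rewrite -[RHS]mul1r -cs1; ring.
Qed.

Lemma enorm_rot p q : enorm (rot c s p - rot c s q) =
  Num.sqrt ((p.1 - q.1) ^+ 2 + (p.2 - q.2) ^+ 2).
Proof.
rewrite /enorm; congr Num.sqrt.
rewrite -[RHS]mul1r -{1}cs1 /dot/=; ring.
Qed.

Lemma frame1 : enorm (c, s) = 1.
Proof. by rewrite /enorm /dot/= -!expr2 cs1 sqrtr1. Qed.

Lemma frame2 : enorm (- s, c) = 1.
Proof. by rewrite /enorm /dot/= mulrNN -!expr2 addrC cs1 sqrtr1. Qed.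

End frame.

(** The sign [sg] allows the same concave function to describe an upper or a
    lower boundary. *)
Section arc_length.
Context {R : realType}.
Variables (c s : R).
Hypothesis cs1 : c ^+ 2 + s ^+ 2 = 1.
Variables (a b : R) (f : R -> R).
Hypothesis cf : continuous f.

Variable sg : R.
Hypothesis sg1 : sg ^+ 2 = 1.

Definition graph_arc t := rot c s (t, sg * f t).
Local Notation arc := graph_arc.

Lemma graph_arc_dist u v : enorm (arc v - arc u) =
  Num.sqrt ((v - u) ^+ 2 + (f v - f u) ^+ 2).
Proof. by rewrite enorm_rot//= -mulrBr exprMn sg1 mul1r. Qed.

Lemma chord_le_hausdorff1 u v : u <= v ->
  ((Num.sqrt ((v - u) ^+ 2 + (f v - f u) ^+ 2))%:E <=
    hausdorff1 (arc @` `]u, v[))%E.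
Proof.
move=> uv; set d := Num.sqrt _.
have dE : d = enorm (arc v - arc u) by rewrite graph_arc_dist.
have [d0|d0] := leP d 0.
  by apply: le_trans (hausdorff1_ge0 _); rewrite lee_fin.
pose w := d^-1 *: (arc v - arc u).
have wE z : dot z w = d^-1 * dot z (arc v - arc u).
  by rewrite dotC dotZl dotC.
have w1 : enorm w = 1.
  rewrite /enorm (_ : dot w w = 1) ?sqrtr1//.
  by rewrite wE dotC wE -enorm_sqr -dE; field; rewrite gt_eqF.
pose F z := dot z w.
have Fuv : F (arc v) - F (arc u) = d.
  by rewrite /F -dotBl wE -enorm_sqr -dE expr2 mulrA mulVf ?mul1r// gt_eqF.
have cFa : continuous (fun t => F (arc t)).
  move=> t; rewrite /F /graph_arc /dot /rot/=.
  by apply: cvgD; apply: cvgM; try exact: cvg_cst; [apply: cvgB|apply: cvgD];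
    apply: cvgM; try exact: cvg_cst; try exact: cvg_id;
    apply: cvgM; try exact: cvg_cst; exact: cf.
rewrite -Fuv; apply: (hausdorff1_ge_projection (dot_lipschitz1 w1)); first lra.
move=> t /andP[t1 t2].
have [|x xuv xt] := @IVT R (fun t => F (arc t)) u v t uv (continuous_subspaceT cFa).
  by apply/andP; split; rewrite ?ge_min ?le_max ?(ltW t1)// ?(ltW t2) ?orbT.
exists (arc x) => //; exists x => //.
move: xuv; rewrite /= !in_itv/= !lt_neqAle => /andP[-> ->]; rewrite !andbT.
apply/andP; split; apply/eqP => xE.
  by move: t1; rewrite xE xt ltxx.
by move: t2; rewrite -xE xt ltxx.
Qed.

Hypothesis vf : concave_on a b f.
Variables (n : nat) (k peak : nat -> R) (e : R).
Hypothesis k_mean : forall x y : R, 0 <= x ->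
  `|Num.sqrt (x ^+ 2 + y ^+ 2) - (\sum_(0 <= i < n) `|y - k i * x|) / n%:R| <= e * x.
Let tilt i t := f t - k i * t.
Hypothesis peakP : forall i, max_at a b (tilt i) (peak i).

(** The length of the graph up to [t], as predicted by the mean of the
    seminorms, up to a constant. *)
Definition mean_climb t := (\sum_(0 <= i < n) climb (tilt i) (peak i) t) / n%:R.

Lemma tilt_concave i : concave_on a b (tilt i).
Proof.
by move=> u v w au uv vw wb; rewrite /tilt; have := vf au uv vw wb; lra.
Qed.

Let tiltB i u v : (f v - f u) - k i * (v - u) = tilt i v - tilt i u.
Proof. by rewrite /tilt; ring. Qed.

Lemma chord_le_climb u v : a <= u -> u <= v -> v <= b ->
  Num.sqrt ((v - u) ^+ 2 + (f v - f u) ^+ 2) <=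
    mean_climb v - mean_climb u + e * (v - u).
Proof.
move=> au uv vb.
have uv0 : 0 <= v - u by lra.
have := k_mean (f v - f u) uv0; rewrite ler_norml => /andP[_ h].
rewrite -lerBlDr; apply: le_trans (_ : _ <= (\sum_(0 <= i < n) `|f v - f u - k i * (v - u)|) / n%:R) _.
  lra.
rewrite -mulrBl -sumrB ler_wpM2r// ler_sum// => i _.
by rewrite tiltB; exact: (climb_dominates (tilt_concave i) (peakP i)).
Qed.

Lemma climb_le_chord u v : a <= u -> u <= v -> v <= b ->
  (forall i, (i < n)%N -> v <= peak i \/ peak i <= u) ->
  mean_climb v - mean_climb u - e * (v - u) <=
  Num.sqrt ((v - u) ^+ 2 + (f v - f u) ^+ 2).
Proof.
move=> au uv vb nopeak.
have uv0 : 0 <= v - u by lra.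
have := k_mean (f v - f u) uv0; rewrite ler_norml => /andP[h _].
have -> : mean_climb v - mean_climb u = (\sum_(0 <= i < n) `|f v - f u - k i * (v - u)|) / n%:R.
  rewrite -mulrBl -sumrB; congr (_ / _); apply: eq_big_nat => i /andP[_ ni].
  by rewrite tiltB; apply: (climb_eq (tilt_concave i) (peakP i)) => //; exact: nopeak.
lra.
Qed.

Lemma hausdorff1_arc_le : a <= b ->
  (hausdorff1 (arc @` `[a, b]) <= (mean_climb b - mean_climb a + e * (b - a))%:E)%E.
Proof.
move=> ab; pose w t := mean_climb t + e * t.
have wE u v : w v - w u = mean_climb v - mean_climb u + e * (v - u) by rewrite /w; ring.
have w_le u v : a <= u -> u <= v -> v <= b ->
    enorm (arc v - arc u) <= w v - w u.
  by move=> au uv vb; rewrite wE graph_arc_dist; exact: chord_le_climb.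
have w_mono u v : a <= u -> u <= v -> v <= b -> w u <= w v.
  move=> au uv vb; rewrite -subr_ge0; apply: le_trans (w_le _ _ au uv vb).
  exact: enorm_ge0.
rewrite -wE; apply: (hausdorff1_le_image (w := w)).
- exact: w_mono.
- move=> u /=; rewrite in_itv/= => /andP[au ub].
  by rewrite !w_mono.
- move=> u v /=; rewrite !in_itv/= => /andP[au ub] /andP[av vb].
  have [uv|/ltW vu] := leP u v.
    rewrite distrC ger0_norm ?subr_ge0 ?w_mono//.
    by rewrite enormC; exact: w_le.
  by rewrite ger0_norm ?subr_ge0 ?w_mono//; exact: w_le.
Qed.

(** Between two consecutive maxima of the functions [tilt i], the chord already
    gives the bound because no variation is lost.  The arc is cut at these
    maxima, one after the other, along lines of constant first coordinate. *)
Lemma hausdorff1_arc_ge u v : a <= u -> u <= v -> v <= b ->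
  ((mean_climb v - mean_climb u - e * (v - u))%:E <= hausdorff1 (arc @` `]u, v[))%E.
Proof.
suff H m : (m <= n)%N -> forall u v, a <= u -> u <= v -> v <= b ->
    (forall i, (m <= i < n)%N -> v <= peak i \/ peak i <= u) ->
    ((mean_climb v - mean_climb u - e * (v - u))%:E <= hausdorff1 (arc @` `]u, v[))%E.
  by move=> au uv vb; apply: (H n) => // i /andP[/leq_ltn_trans/[apply]]; rewrite ltnn.
elim: m => [|m IH] mn {}u {}v au uv vb nopeak.
  apply: le_trans (chord_le_hausdorff1 uv); rewrite lee_fin.
  exact: climb_le_chord.
have [vp|pv] := leP v (peak m).
  apply: IH => // [|i /andP[]]; first exact: ltnW.
  rewrite leq_eqVlt => /predU1P[<-|mi ni]; first by left.
  by apply: nopeak; rewrite mi.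
have [pu|up] := leP (peak m) u.
  apply: IH => // [|i /andP[]]; first exact: ltnW.
  rewrite leq_eqVlt => /predU1P[<-|mi ni]; first by right.
  by apply: nopeak; rewrite mi.
rewrite (lipschitz1_caratheodory (peak m) (dot_lipschitz1 (frame1 cs1))).
rewrite (_ : _ - _ = (mean_climb (peak m) - mean_climb u - e * (peak m - u)) +
  (mean_climb v - mean_climb (peak m) - e * (v - peak m))); last by ring.
rewrite EFinD; apply: leeD.
  apply: le_trans (IH (ltnW mn) u (peak m) au (ltW up) _ _) _.
  - lra.
  - move=> i /andP[]; rewrite leq_eqVlt => /predU1P[<-|mi ni]; first by left.
    have [|? |?] := nopeak i; first by rewrite mi.
      by left; lra.
    by right.
  apply: le_hausdorff1 => _ [x + <-]; rewrite /= in_itv/= => /andP[ux xp].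
  split; first by exists x => //=; rewrite in_itv/=; apply/andP; split; lra.
  by rewrite /= rot_dot1// ltW.
apply: le_trans (IH (ltnW mn) (peak m) v _ (ltW pv) vb _) _.
- lra.
- move=> i /andP[]; rewrite leq_eqVlt => /predU1P[<-|mi ni]; first by right.
  have [|? |?] := nopeak i; first by rewrite mi.
    by left.
  by right; lra.
apply: le_hausdorff1 => _ [x + <-]; rewrite /= in_itv/= => /andP[ux xp].
split; first by exists x => //=; rewrite in_itv/=; apply/andP; split; lra.
by rewrite /= rot_dot1//=; apply/negP; rewrite -ltNge.
Qed.

End arc_length.

(** * The boundary of a convex body *)

Section convex_body.
Context {R : realType}.
Variables (Omega : set (R * R)) (c s a b : R).
Hypothesis cptO : compact Omega.
Hypothesis cvxO : convex_set Omega.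
Hypothesis intO : interior Omega !=set0.
Hypothesis cs1 : c ^+ 2 + s ^+ 2 = 1.
Hypothesis ab : a < b.
Hypothesis rangeO : [set dot z (c, s) | z in Omega] = `[a, b]%classic.

Local Notation theta := (c, s).
Local Notation eta := (- s, c).
Local Notation up := (top Omega theta eta a b).
Local Notation down := (top Omega theta (- eta) a b).

Lemma mem_body z : Omega z <->
  a <= dot z theta <= b /\ - down (dot z theta) <= dot z eta <= up (dot z theta).
Proof.
split=> [Oz|[zab /andP[zd zu]]].
  split; first exact: (range_in rangeO).
  rewrite lerNl -dotNr; apply/andP; split; exact: (le_top _ cptO rangeO).
have [p [Op pt pu _]] := top_max eta cptO rangeO zab.
have [q [Oq qt qd _]] := top_max (- eta) cptO rangeO zab.
rewrite dotNr in qd.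
set t := dot z theta in zab zd zu pt pu qt qd *; set y := dot z eta in zd zu *.
have [k [k01 ky]] : exists k, 0 <= k <= 1 /\ k * up t + (1 - k) * (- down t) = y.
  have [fd|df] := leP (up t) (- down t).
    by exists 1; rewrite lexx ler01; split=> //; lra.
  exists ((y + down t) / (up t + down t)); split.
    apply/andP; split; first by rewrite divr_ge0; lra.
    by rewrite ler_pdivrMr; lra.
  by field; lra.
have := convexP cvxO k01 Op Oq; rewrite (_ : _ + _ = z)//.
rewrite -[RHS](rot_coords cs1 z) -[LHS](rot_coords cs1) !dotDl !dotZl pt qt pu.
rewrite (_ : dot q eta = - down t); last by rewrite -qd opprK.
by rewrite ky (_ : k * t + (1 - k) * t = t)//; ring.
Qed.

Lemma rot_mem_body t y : a <= t <= b -> - down t <= y <= up t -> Omega (rot c s (t, y)).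
Proof. by move=> tab ytu; apply/mem_body; rewrite rot_dot1// rot_dot2. Qed.

Lemma interior_move z u : interior Omega z -> exists2 d, 0 < d & Omega (z + d *: u).
Proof.
move=> Iz; have : (fun d : R => z + d *: u) @ (0 : R) --> z.
  rewrite -[X in _ --> X]addr0 -(scale0r u).
  by apply: cvgD; [exact: cvg_cst|apply: cvgZl; exact: cvg_id].
move=> /(_ _ Iz)/nbhs_ballP[d /= d0 dI]; exists (d / 2); first by rewrite divr_gt0.
by apply: dI; rewrite /ball/= sub0r normrN gtr0_norm ?divr_gt0//; lra.
Qed.

Lemma interior_strict z : interior Omega z ->
  a < dot z theta < b /\ - down (dot z theta) < dot z eta < up (dot z theta).
Proof.
move=> Iz.
have [d1 d10 /mem_body[/andP[_ +] _]] := interior_move theta Iz.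
have [d2 d20 /mem_body[/andP[+ _] _]] := interior_move (- theta) Iz.
have [d3 d30 /mem_body[_ /andP[_ +]]] := interior_move eta Iz.
have [d4 d40 /mem_body[_ /andP[+ _]]] := interior_move (- eta) Iz.
rewrite !dotDl !dotZl.
have -> : dot theta theta = 1 by rewrite -cs1 /dot/=; ring.
have -> : dot (- theta) theta = -1 by rewrite -cs1 /dot/=; ring.
have -> : dot eta theta = 0 by rewrite /dot/=; ring.
have -> : dot (- eta) theta = 0 by rewrite /dot/=; ring.
have -> : dot eta eta = 1 by rewrite -cs1 /dot/=; ring.
have -> : dot (- eta) eta = -1 by rewrite -cs1 /dot/=; ring.
rewrite !mulr0 !addr0 => h4 h3 h2 h1.
by split; apply/andP; split; lra.
Qed.

Lemma chord_ge0 t : a <= t <= b -> 0 <= up t + down t.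
Proof.
move=> tab; have [z [Oz zt zu _]] := top_max eta cptO rangeO tab.
by have := le_top (- eta) cptO rangeO Oz; rewrite dotNr zt zu; lra.
Qed.

Lemma chord_gt0 t : a < t < b -> 0 < up t + down t.
Proof.
move=> /andP[at_ tb]; have [z0 Iz0] := intO.
have [/andP[ax xb] /andP[du uu]] := interior_strict Iz0.
set x := dot z0 theta in ax xb du uu.
have vu := top_concave eta cptO cvxO rangeO.
have vd := top_concave (- eta) cptO cvxO rangeO.
have fa := chord_ge0 (_ : a <= a <= b); have fb := chord_ge0 (_ : a <= b <= b).
have {}fa : 0 <= up a + down a by apply: fa; rewrite lexx ltW.
have {}fb : 0 <= up b + down b by apply: fb; rewrite lexx ltW.
have [tx|/ltW xt] := leP t x.
  have h1 := vu a t x (lexx _) (ltW at_) tx (ltW xb).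
  have h2 := vd a t x (lexx _) (ltW at_) tx (ltW xb).
  rewrite -(pmulr_rgt0 _ (_ : 0 < x - a)); last lra.
  have p1 : 0 < (t - a) * (up x + down x) by apply: mulr_gt0; lra.
  have p2 : 0 <= (x - t) * (up a + down a) by apply: mulr_ge0; lra.
  lra.
have h1 := vu x t b (ltW ax) xt (ltW tb) (lexx _).
have h2 := vd x t b (ltW ax) xt (ltW tb) (lexx _).
rewrite -(pmulr_rgt0 _ (_ : 0 < b - x)); last lra.
have p1 : 0 < (b - t) * (up x + down x) by apply: mulr_gt0; lra.
have p2 : 0 <= (t - x) * (up b + down b) by apply: mulr_ge0; lra.
lra.
Qed.

Lemma boundary_body z : boundary Omega z <-> Omega z /\
  [\/ dot z theta = a, dot z theta = b, dot z eta = up (dot z theta) |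
      dot z eta = - down (dot z theta)].
Proof.
split=> [[clz nIz]|[Oz zb]]; last first.
  split; first exact: subset_closure.
  move=> /interior_strict[/andP[az bz] /andP[dz uz]].
  by case: zb => h; move: az bz dz uz; rewrite -?h ?ltxx// h ltxx.
have Oz : Omega z by move: clz; apply: compact_closed => //; exact: norm_hausdorff.
split=> //; have [/andP[az zb] /andP[zd zu]] := (mem_body z).1 Oz.
have [<-|za] := eqVneq (dot z theta) a; first by constructor 1.
have [<-|zb'] := eqVneq (dot z theta) b; first by constructor 2.
have [<-|zu'] := eqVneq (dot z eta) (up (dot z theta)); first by constructor 3.
have [zd'|zd'] := eqVneq (dot z eta) (- down (dot z theta)); first by constructor 4.
exfalso; apply: nIz; rewrite /interior/=.
have cX := @dot_continuous R theta; have cY := @dot_continuous R eta.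
have cU : continuous up by exact: top_continuous.
have cD : continuous down by exact: top_continuous.
have near_gt (G : R * R -> R) : continuous G -> 0 < G z -> \forall z' \near z, 0 < G z'.
  by move=> cG Gz; exact: (cvgr_gt (G z) (cG z)).
have n1 : \forall z' \near z, 0 < dot z' theta - a.
  by apply: near_gt; [move=> ?; apply: cvgB; [exact: cX|exact: cvg_cst]|
     rewrite subr_gt0 lt_neqAle eq_sym za].
have n2 : \forall z' \near z, 0 < b - dot z' theta.
  by apply: near_gt; [move=> ?; apply: cvgB; [exact: cvg_cst|exact: cX]|
     rewrite subr_gt0 lt_neqAle zb'].
have n3 : \forall z' \near z, 0 < up (dot z' theta) - dot z' eta.
  apply: near_gt; last by rewrite subr_gt0 lt_neqAle zu'.
  by move=> y; apply: cvgB; [exact: (continuous_comp (cX y) (cU _))|exact: cY].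
have n4 : \forall z' \near z, 0 < dot z' eta + down (dot z' theta).
  apply: near_gt; last by rewrite -(opprK (down _)) subr_gt0 lt_neqAle eq_sym zd'.
  by move=> y; apply: cvgD; [exact: cY|exact: (continuous_comp (cX y) (cD _))].
near=> z'; apply/mem_body; split; apply/andP; split.
- by rewrite -subr_ge0; apply: ltW; near: z'.
- by rewrite -subr_ge0; apply: ltW; near: z'.
- by rewrite -subr_ge0 opprK; apply: ltW; near: z'.
- by rewrite -subr_ge0; apply: ltW; near: z'.
Unshelve. all: by end_near. Qed.

End convex_body.

(** * First moments of the boundary and of the body *)

Section layer_cake.
Local Open Scope ereal_scope.
Context d (T : measurableType d) (R : realType) (mu : {measure set T -> \bar R}).

(** Tonelli for the region under the graph of [g], over the finite restriction
    of [mu] to [D]. *)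
Lemma layer_cake (D : set T) (g : T -> R) (a b : R) : measurable D -> mu D < +oo ->
  measurable_fun [set: T] g -> (forall z, D z -> (a <= g z <= b)%R) ->
  measurable_fun `[a, b]%classic
    (fun t : measurableTypeR R => mu (D `&` [set z | (t <= g z)%R])) /\
  \int[mu]_(z in D) (g z - a)%:E =
  \int[lebesgue_measure]_(t in `[a, b]) mu (D `&` [set z | (t <= g z)%R]).
Proof.
move=> mD Dfin mg Dg.
pose m1 : {finite_measure set T -> \bar R} := mfrestr mD Dfin.
pose S : set (T * measurableTypeR R) := [set p | D p.1 /\ (a <= p.2 <= g p.1)%R].
have mS : measurable S.
  rewrite (_ : S = (fst @^-1` D) `&` ([set p | (a <= p.2)%R] `&` [set p | (p.2 <= g p.1)%R])).
    apply: measurableI; first by rewrite -[X in measurable X]setTI; exact: measurable_fst.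
    apply: measurableI; rewrite -[X in measurable X]setTI; apply: measurable_fun_le => //.
    exact: (measurableT_comp mg measurable_fst).
  by apply/seteqP; split => p /=; [move=> [Dp /andP[? ?]]|move=> [Dp [? ?]]; split=> //; apply/andP].
have SE (t : R) : (a <= t <= b)%R ->
    mu (D `&` [set z | (t <= g z)%R]) = m1 (ysection S t).
  move=> tab; rewrite /m1 /= /mfrestr /mrestr; congr (mu _).
  apply/seteqP; split => z /=; rewrite /ysection/= inE.
    by move=> [Dz tg]; split=> //; split=> //; move: tab => /andP[-> _].
  by move=> [[Dz /andP[_ tg]] _].
split.
  apply: (eq_measurable_fun (m1 \o ysection S)).
    by move=> t; rewrite inE/= in_itv/= => /SE.
  by apply: (measurable_funS measurableT) => //; exact: measurable_fun_ysection.
have := @indic_fubini_tonelli _ _ _ _ R m1 (@lebesgue_measure R) S mS.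
rewrite indic_fubini_tonelli_FE// indic_fubini_tonelli_GE//.
have -> : \int[m1]_x ((@lebesgue_measure R) \o xsection S) x = \int[mu]_(z in D) (g z - a)%:E.
  rewrite [RHS](@eq_measure_integral _ _ _ D m1 mu); last first.
    by move=> A mA AD; rewrite /m1 /= /mfrestr /mrestr setIidl.
  rewrite integral_mkcond; apply: eq_integral => z _; rewrite patchE /=.
  case: ifPn => [|/negP]; rewrite inE => Dz.
    rewrite (_ : xsection S z = `[a, g z]%classic).
      have /andP[ag _] := Dg _ Dz.
      rewrite lebesgue_measure_itv/= lte_fin; case: ltP => // ga.
      by rewrite (_ : g z = a) ?subrr//; apply/eqP; rewrite eq_le ag ga.
    apply/seteqP; split => t /=; rewrite /xsection/= inE in_itv/=; first by move=> [].
    by [].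
  rewrite (_ : xsection S z = set0) ?measure0//.
  by apply/seteqP; split => t //=; rewrite /xsection/= inE => -[].
move=> ->; rewrite [RHS]integral_mkcond; apply: eq_integral => t _; rewrite patchE /=.
case: ifPn => [|/negP]; rewrite inE /= in_itv /= => tab; first by rewrite SE.
rewrite /m1 /= /mfrestr /mrestr.
rewrite (_ : _ `&` _ = set0) ?measure0//.
apply/seteqP; split => z //=; rewrite /ysection/= inE => -[[Dz /andP[at_ tg]] _].
apply: tab; rewrite at_/= (le_trans tg)//.
by have /andP[] := Dg _ Dz.
Qed.

End layer_cake.

Section measurability.
Context {R : realType}.
Local Notation C := (caratheodory_type (@hausdorff1 R)).
Local Notation T := (measurableTypeR R * measurableTypeR R)%type.

Lemma measurable_dot_arclength (w : R * R) : enorm w = 1 ->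
  measurable_fun [set: C] (fun z : C => dot (z : R * R) w : measurableTypeR R).
Proof.
move=> w1 _; apply: (measurability _ (RGenOInfty.measurableE R)) => // _ [_ [x ->] <-].
rewrite setTI (_ : _ @^-1` _ = ~` [set z | dot z w <= x]).
  apply: measurableC; exact: (lipschitz1_caratheodory x (dot_lipschitz1 w1)).
by apply/seteqP; split => z /=; rewrite in_itv/= andbT ltNge => /negP.
Qed.

Lemma measurable_dot_area (w : R * R) :
  measurable_fun [set: T] (fun z : T => dot (z : R * R) w : measurableTypeR R).
Proof. by apply: measurable_funD; apply: measurable_funM. Qed.

Lemma continuous_measurable (f : R -> R) : continuous f ->
  measurable_fun [set: measurableTypeR R] (f : measurableTypeR R -> measurableTypeR R).
Proof. by move=> cf; exact: continuous_measurable_fun. Qed.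

End measurability.

Section body_measures.
Context {R : realType}.
Variables (Omega : set (R * R)) (c s a b : R).
Hypothesis cptO : compact Omega.
Hypothesis cvxO : convex_set Omega.
Hypothesis intO : interior Omega !=set0.
Hypothesis cs1 : c ^+ 2 + s ^+ 2 = 1.
Hypothesis ab : a < b.
Hypothesis rangeO : [set dot z (c, s) | z in Omega] = `[a, b]%classic.

Local Notation theta := (c, s).
Local Notation eta := (- s, c).
Local Notation up := (top Omega theta eta a b).
Local Notation down := (top Omega theta (- eta) a b).
Local Notation C := (caratheodory_type (@hausdorff1 R)).
Local Notation RR := (measurableTypeR R).
Local Notation T := (RR * RR)%type.

Let up_cont : continuous up. Proof. exact: top_continuous. Qed.
Let down_cont : continuous down. Proof. exact: top_continuous. Qed.

Let coord_sets (d : measure_display) (S : measurableType d) (X Y : S -> RR) :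
  measurable_fun [set: S] X -> measurable_fun [set: S] Y ->
  [/\ measurable [set z | a <= X z <= b /\ - down (X z) <= Y z <= up (X z)],
      measurable [set z | X z = a], measurable [set z | X z = b],
      measurable [set z | Y z = up (X z)] & measurable [set z | Y z = - down (X z)]].
Proof.
move=> mX mY.
have mU : measurable_fun [set: S] (fun z => up (X z) : RR).
  exact: measurableT_comp (continuous_measurable up_cont) mX.
have mD : measurable_fun [set: S] (fun z => - down (X z) : RR).
  by apply: measurable_funN; exact: measurableT_comp (continuous_measurable down_cont) mX.
have le (F G : S -> RR) : measurable_fun [set: S] F -> measurable_fun [set: S] G ->
    measurable [set z | F z <= G z].
  by move=> mF mG; rewrite -[X in measurable X]setTI; exact: measurable_fun_le.
have eq (F G : S -> RR) : measurable_fun [set: S] F -> measurable_fun [set: S] G ->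
    measurable [set z | F z = G z].
  move=> mF mG; rewrite (_ : [set _ | _] = [set z | F z <= G z] `&` [set z | G z <= F z]).
    by apply: measurableI; exact: le.
  apply/seteqP; split => z /=; first by move=> ->.
  by move=> [FG GF]; apply/eqP; rewrite eq_le FG.
split; [|exact: eq..].
rewrite (_ : [set _ | _] = ([set z | a <= X z] `&` [set z | X z <= b]) `&`
   ([set z | - down (X z) <= Y z] `&` [set z | Y z <= up (X z)])).
  by apply: measurableI; apply: measurableI; exact: le.
apply/seteqP; split => z /=; first by move=> [/andP[? ?] /andP[? ?]].
by move=> [[? ?] [? ?]]; split; apply/andP.
Qed.

Let measurable_below_middle (d : measure_display) (S : measurableType d) (X Y : S -> RR) :
  measurable_fun [set: S] X -> measurable_fun [set: S] Y ->
  measurable [set z | Y z <= (up (X z) - down (X z)) / 2].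
Proof.
move=> mX mY; rewrite -[X in measurable X]setTI; apply: measurable_fun_le => //.
apply: measurable_funM => //; apply: measurable_funB.
  exact: measurableT_comp (continuous_measurable up_cont) mX.
exact: measurableT_comp (continuous_measurable down_cont) mX.
Qed.

Lemma measurable_body : measurable (Omega : set T).
Proof.
have [mO _ _ _ _] := coord_sets (measurable_dot_area theta) (measurable_dot_area eta).
rewrite (_ : (Omega : set T) = [set z : T | a <= dot z theta <= b /\
  - down (dot z theta) <= dot z eta <= up (dot z theta)])//.
by apply/seteqP; split => z /=; move/(mem_body cptO cvxO cs1 rangeO).
Qed.

Lemma measurable_boundary : measurable (boundary Omega : set C).
Proof.
have [mO ma mb mu_ md] := coord_sets (measurable_dot_arclength (frame1 cs1))
  (measurable_dot_arclength (frame2 cs1)).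
rewrite (_ : (boundary Omega : set C) =
  [set z : C | a <= dot z theta <= b /\ - down (dot z theta) <= dot z eta <= up (dot z theta)] `&` (([set z | dot z theta = a] `|`
  [set z | dot z theta = b]) `|` ([set z | dot z eta = up (dot z theta)] `|`
  [set z | dot z eta = - down (dot z theta)]))).
  by apply: measurableI; [exact: mO|apply: measurableU; exact: measurableU].
apply/seteqP; split => z /=.
  move/(boundary_body cptO cvxO cs1 ab rangeO) => -[/(mem_body cptO cvxO cs1 rangeO) Oz h].
  by split=> //; case: h => ?; [left; left|left; right|right; left|right; right].
move=> [/(mem_body cptO cvxO cs1 rangeO) Oz h].
apply/(boundary_body cptO cvxO cs1 ab rangeO); split=> //.
by case: h => -[] ?; [constructor 1|constructor 2|constructor 3|constructor 4].
Qed.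

Lemma integral_body (h : R -> R) : continuous h ->
  (forall t, a <= t <= b -> 0 <= h t) ->
  (\int[area]_(z in Omega) (h (dot z theta))%:E =
   (\int_(a, b) (fun t => h t * (up t + down t)))%:E)%E.
Proof.
move=> ch h0.
have cg : continuous (fun t => h t * (up t + down t)).
  by move=> t; apply: cvgM; [exact: ch|apply: cvgD; [exact: up_cont|exact: down_cont]].
have mO := measurable_body.
rewrite integral_mkcond; set F := _ \_ _.
have F0 z : (0 <= F z)%E.
  rewrite /F patchE; case: ifPn => //; rewrite inE => Oz; rewrite lee_fin h0//.
  exact: (range_in rangeO).
have mF : measurable_fun [set: T] F.
  apply/(measurable_restrictT _ mO); apply: (measurable_funS measurableT) => //.
  apply/measurable_EFinP.
  exact: measurableT_comp (continuous_measurable ch) (measurable_dot_area theta).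
rewrite -(integral_rot cs1 mF F0) /area fubini_tonelli1//; last first.
  exact: measurableT_comp mF (measurable_rot c s).
rewrite /segint /Rintegral fineK; last first.
  by apply: integrable_fin_num => //; exact: continuous_integrable.
rewrite [RHS]integral_mkcond; apply: eq_integral => t _.
rewrite /fubini_F patchE; case: ifPn => [|/negP]; rewrite inE/= in_itv/= => tab; last first.
  apply: integral0_eq => y _; rewrite /F patchE ifF//.
  apply/negP; rewrite inE => /(range_in rangeO); rewrite rot_dot1//.
transitivity (\int[@lebesgue_measure R]_(y in `[(- down t)%R, up t]) (h t)%:E)%E.
  rewrite [RHS]integral_mkcond; apply: eq_integral => y _.
  rewrite /F !patchE; congr (if _ then _ else _); last by rewrite rot_dot1.
  apply/idP/idP; rewrite !inE/= in_itv/=.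
    by move/(mem_body cptO cvxO cs1 rangeO); rewrite rot_dot1// rot_dot2// => -[].
  exact: (rot_mem_body cptO cvxO cs1 rangeO).
rewrite integral_cst//= lebesgue_measure_itv/= lte_fin EFinM.
have f0 := chord_ge0 cptO rangeO tab.
case: ltP => [_|ud]; first by rewrite -EFinB opprK.
by rewrite (_ : up t + down t = 0)//; lra.
Qed.

Lemma area_gt0 : 0 < \int_(a, b) (fun t => up t + down t).
Proof.
apply: int_gt0 => // [t|t tab|t tab].
- by apply: cvgD; [exact: up_cont|exact: down_cont].
- exact: (chord_ge0 cptO rangeO).
- exact: (chord_gt0 cptO cvxO intO cs1 ab rangeO).
Qed.

Let up_conc : concave_on a b up. Proof. exact: top_concave. Qed.
Let down_conc : concave_on a b down. Proof. exact: top_concave. Qed.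

Variables (e : R) (n : nat) (k p1 p2 : nat -> R).
Hypothesis e0 : 0 < e.
Hypothesis n0 : (0 < n)%N.
Hypothesis k_mean : forall x y : R, 0 <= x ->
  `|Num.sqrt (x ^+ 2 + y ^+ 2) - (\sum_(0 <= i < n) `|y - k i * x|) / n%:R| <= e * x.
Let f1 i t := up t - k i * t.
Let f2 i t := down t - (- k i) * t.
Hypothesis p1P : forall i, max_at a b (f1 i) (p1 i).
Hypothesis p2P : forall i, max_at a b (f2 i) (p2 i).

Let k_meanN (x y : R) : 0 <= x ->
  `|Num.sqrt (x ^+ 2 + y ^+ 2) - (\sum_(0 <= i < n) `|y - (- k i) * x|) / n%:R| <= e * x.
Proof.
move=> x0; have := k_mean (- y) x0; rewrite sqrrN; congr (`|_ - _ / _| <= _).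
by apply: eq_bigr => i _; rewrite -normrN; congr `|_|; ring.
Qed.

Let V1 t := mean_climb up n k p1 t.
Let V2 t := mean_climb down n (fun i => - k i) p2 t.
(** The mean over [i] of the numbers [W] of the one-dimensional inequality. *)
Let half_perimeter := (\sum_(0 <= i < n) (f1 i (p1 i) + f2 i (p2 i))) / n%:R.

Let n0' : n%:R != 0 :> R. Proof. by rewrite pnatr_eq0 -lt0n. Qed.

Let mean_const (x : R) : (\sum_(0 <= i < n) x) / n%:R = x.
Proof. by rewrite sumr_const_nat subn0 -[x *+ n]mulr_natr mulfK. Qed.

Let climb_start : V1 a + V2 a = up a + down a.
Proof.
rewrite -mulrDl -big_split/= -[RHS]mean_const; congr (_ / _).
apply: eq_bigr => i _.
have [/andP[ap _] _] := p1P i; have [/andP[ap' _] _] := p2P i.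
by rewrite !climbl//; ring.
Qed.

Let climb_end : V1 b + V2 b = 2 * half_perimeter - (up b + down b).
Proof.
rewrite -mulrDl -big_split/= -[X in _ = _ - X]mean_const mulrA -mulrBl; congr (_ / _).
rewrite mulr_sumr -sumrB; apply: eq_bigr => i _.
have [/andP[_ pb] _] := p1P i; have [/andP[_ pb'] _] := p2P i.
by rewrite !climbr// /f1 /f2; ring.
Qed.

Let arc1 := graph_arc c s up 1.
Let arc2 := graph_arc c s down (-1).
Let side t y := rot c s (t, y).

Let side_le t : a <= t <= b ->
  (hausdorff1 (side t @` `[(- down t)%R, up t]) <= (up t + down t)%:E)%E.
Proof.
move=> tab; have f0 := chord_ge0 cptO rangeO tab.
rewrite -[down t in leRHS]opprK; apply: (hausdorff1_le_image (w := id)); first lra.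
  by move=> u /=; rewrite in_itv.
by move=> u v _ _; rewrite enorm_rot//= subrr expr0n/= add0r sqrtr_sqr.
Qed.

Let side_ge t E : a <= t <= b -> side t @` `](- down t)%R, up t[ `<=` E ->
  ((up t + down t)%:E <= hausdorff1 E)%E.
Proof.
move=> tab sE; have f0 := chord_ge0 cptO rangeO tab.
rewrite -[down t in leLHS]opprK.
apply: (hausdorff1_ge_projection (dot_lipschitz1 (frame2 cs1))); first lra.
move=> y yt; exists (side t y); last by rewrite /side rot_dot2.
by apply: sE; exists y => //=; rewrite in_itv.
Qed.

Let sqr1 : 1 ^+ 2 = 1 :> R. Proof. by rewrite expr1n. Qed.
Let sqrN1 : (-1) ^+ 2 = 1 :> R. Proof. by rewrite sqrrN expr1n. Qed.

Lemma perimeter_le :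
  (hausdorff1 (boundary Omega) <= (2 * half_perimeter + 2 * e * (b - a))%:E)%E.
Proof.
have aab : a <= a <= b by rewrite lexx ltW.
have bab : a <= b <= b by rewrite lexx ltW.
have h1 := hausdorff1_arc_le cs1 sqr1 up_conc k_mean p1P (ltW ab).
have h2 := hausdorff1_arc_le cs1 sqrN1 down_conc k_meanN p2P (ltW ab).
have h3 := side_le aab; have h4 := side_le bab.
apply: (@le_trans _ _ (hausdorff1 ((arc1 @` `[a, b] `|` arc2 @` `[a, b]) `|`
   (side a @` `[(- down a)%R, up a] `|` side b @` `[(- down b)%R, up b])))).
  apply: le_hausdorff1 => z /(boundary_body cptO cvxO cs1 ab rangeO)[Oz zb].
  have [/= xab yud] := (mem_body cptO cvxO cs1 rangeO z).1 Oz.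
  case: zb => zE.
  - right; left; exists (dot z eta); last by rewrite /side -[RHS](rot_coords cs1) zE.
    by rewrite /= in_itv/= -[X in up X]zE -[X in down X]zE.
  - right; right; exists (dot z eta); last by rewrite /side -[RHS](rot_coords cs1) zE.
    by rewrite /= in_itv/= -[X in up X]zE -[X in down X]zE.
  - left; left; exists (dot z theta); first by rewrite /= in_itv.
    by rewrite /arc1 /graph_arc mul1r -zE rot_coords.
  - left; right; exists (dot z theta); first by rewrite /= in_itv.
    by rewrite /arc2 /graph_arc mulN1r -zE rot_coords.
apply: le_trans (outer_measureU2 (@hausdorff1 R) _ _) _.
apply: le_trans (leeD (outer_measureU2 (@hausdorff1 R) _ _)
                      (outer_measureU2 (@hausdorff1 R) _ _)) _.
apply: le_trans (leeD (leeD h1 h2) (leeD h3 h4)) _.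
rewrite -!EFinD lee_fin; have := climb_start; have := climb_end.
by rewrite /V1 /V2; lra.
Qed.

(** The part of the boundary beyond [t] contains two arcs and the side over
    [b].  The side is split off by a half-plane and the arcs are separated by
    the midline between the two boundaries. *)
Let cap_ge t : a <= t <= b ->
  ((2 * half_perimeter - V1 t - V2 t - 2 * e * (b - t))%:E <=
    hausdorff1 (boundary Omega `&` [set z : R * R | (t <= dot z theta)%R]))%E.
Proof.
move=> /andP[at_ tb]; set E := _ `&` _.
have bab : a <= b <= b by rewrite lexx ltW.
have h1 := hausdorff1_arc_ge cs1 up_cont sqr1 up_conc k_mean p1P at_ tb (lexx b).
have h2 := hausdorff1_arc_ge cs1 down_cont sqrN1 down_conc k_meanN p2P at_ tb (lexx b).
have arcs u : t < u < b -> E (arc1 u) /\ E (arc2 u).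
  move=> /andP[tu ub]; have uab : a <= u <= b by apply/andP; split; lra.
  have f0 := chord_ge0 cptO rangeO uab.
  split; (split; last by rewrite /= rot_dot1//= ltW);
    apply/(boundary_body cptO cvxO cs1 ab rangeO); split.
  - by apply: (rot_mem_body cptO cvxO cs1 rangeO) => //; apply/andP; split; lra.
  - by constructor 3; rewrite rot_dot1// rot_dot2//= mul1r.
  - by apply: (rot_mem_body cptO cvxO cs1 rangeO) => //; apply/andP; split; lra.
  - by constructor 4; rewrite rot_dot1// rot_dot2//= mulN1r.
pose M := [set z | dot z eta <= (up (dot z theta) - down (dot z theta)) / 2].
have mM : (@hausdorff1 R).-caratheodory M.
  exact: (measurable_below_middle (measurable_dot_arclength (frame1 cs1))
    (measurable_dot_arclength (frame2 cs1))).
rewrite (lipschitz1_caratheodory (- b) (dot_lipschitz1 (_ : enorm (- theta) = 1))); last first.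
  by rewrite -(frame1 cs1) /enorm /dot/=; congr Num.sqrt; ring.
set A := [set z | _]; rewrite (mM (E `&` ~` A)).
have -> : 2 * half_perimeter - V1 t - V2 t - 2 * e * (b - t) = (up b + down b) +
   ((V2 b - V2 t - e * (b - t)) + (V1 b - V1 t - e * (b - t))).
  by have := climb_end; lra.
rewrite !EFinD; apply: leeD; last apply: leeD.
- apply: side_ge => // _ [y + <-]; rewrite /= in_itv/= => /andP[yd yu].
  split; last by rewrite /A/= dotNr rot_dot1.
  split; last by rewrite /= rot_dot1.
  apply/(boundary_body cptO cvxO cs1 ab rangeO); split.
    by apply: (rot_mem_body cptO cvxO cs1 rangeO) => //; rewrite !ltW.
  by constructor 2; rewrite rot_dot1.
- apply: le_trans h2 _; apply: le_hausdorff1 => _ [u /=] + <-; rewrite in_itv/= => tub.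
  have tub' : a < u < b by move: tub => /andP[? ?]; apply/andP; split; lra.
  have f0 := chord_gt0 cptO cvxO intO cs1 ab rangeO tub'.
  have [_ Eu] := arcs _ tub; move: tub => /andP[tu ub].
  split; last first.
    rewrite /M/= rot_dot1// rot_dot2//= mulN1r; lra.
  by split=> //; rewrite /A/= dotNr rot_dot1//= lerN2; apply/negP; rewrite -ltNge.
- apply: le_trans h1 _; apply: le_hausdorff1 => _ [u /=] + <-; rewrite in_itv/= => tub.
  have tub' : a < u < b by move: tub => /andP[? ?]; apply/andP; split; lra.
  have f0 := chord_gt0 cptO cvxO intO cs1 ab rangeO tub'.
  have [Eu _] := arcs _ tub; move: tub => /andP[tu ub].
  split; last first.
    rewrite /M/= rot_dot1// rot_dot2//= mul1r; apply/negP; rewrite -ltNge; lra.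
  by split=> //; rewrite /A/= dotNr rot_dot1//= lerN2; apply/negP; rewrite -ltNge.
Qed.

Let f1_cont i : continuous (f1 i).
Proof.
by move=> t; apply: cvgB; [exact: up_cont|apply: cvgM; [exact: cvg_cst|exact: cvg_id]].
Qed.

Let f2_cont i : continuous (f2 i).
Proof.
by move=> t; apply: cvgB; [exact: down_cont|apply: cvgM; [exact: cvg_cst|exact: cvg_id]].
Qed.

Let f1_conc i : concave_on a b (f1 i). Proof. exact: (tilt_concave up_conc k). Qed.
Let f2_conc i : concave_on a b (f2 i).
Proof. exact: (tilt_concave down_conc (fun i => - k i)). Qed.

(** The lower bound on the length beyond [t], up to the error term. *)
Let tail t := 2 * half_perimeter - V1 t - V2 t.
Let tail_at i t := 2 * (f1 i (p1 i) + f2 i (p2 i)) - climb (f1 i) (p1 i) t - climb (f2 i) (p2 i) t.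

Let tail_at_cont i : continuous (tail_at i).
Proof.
by move=> t; apply: cvgB; [apply: cvgB; [exact: cvg_cst|]|];
  apply: climb_continuous; [exact: f1_cont|exact: f2_cont].
Qed.

Let tailE : tail = fun t => n%:R^-1 * \sum_(0 <= i < n) tail_at i t.
Proof.
apply/funext => t; rewrite /tail /V1 /V2 /mean_climb /half_perimeter mulrA -!mulrBl mulrC.
by rewrite mulr_sumr -!sumrB.
Qed.

Let tail_cont : continuous tail.
Proof.
rewrite tailE => t; apply: cvgM; first exact: cvg_cst.
by have [+ _] := int_sum a b n tail_at_cont; apply.
Qed.

Let tail_ge0 t : a <= t <= b -> 0 <= tail t.
Proof.
move=> /andP[at_ tb]; rewrite tailE mulr_ge0 ?invr_ge0 ?ler0n// sumr_ge0// => i _.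
have h1 := climb_nondecreasing (f1_conc i) (p1P i) at_ tb (lexx b).
have h2 := climb_nondecreasing (f2_conc i) (p2P i) at_ tb (lexx b).
have [/andP[_ p1b] _] := p1P i; have [/andP[_ p2b] _] := p2P i.
rewrite (climbr _ p1b) in h1; rewrite (climbr _ p2b) in h2.
have bab : a <= b <= b by rewrite lexx ltW.
have f0 := chord_ge0 cptO rangeO bab.
have fE : f1 i b + f2 i b = up b + down b by rewrite /f1 /f2; ring.
by rewrite /tail_at; lra.
Qed.

Let area0 := \int_(a, b) (fun t => up t + down t).
Let area1 := \int_(a, b) (fun t => (t - a) * (up t + down t)).

(** The one-dimensional inequality, averaged over [i]; tilting by [k i] leaves
    the chord unchanged. *)
Let tail_moment : 2 * half_perimeter * area1 <=
  (\int_(a, b) tail + half_perimeter * (b - a) / 3) * area0.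
Proof.
have tint : \int_(a, b) tail = (\sum_(0 <= i < n) \int_(a, b) (tail_at i)) / n%:R.
  rewrite tailE intZ; last by have [] := int_sum a b n tail_at_cont.
  by have [_ ->] := int_sum a b n tail_at_cont; rewrite mulrC.
have one i : 2 * (f1 i (p1 i) + f2 i (p2 i)) * area1 <=
    (\int_(a, b) (tail_at i) + (f1 i (p1 i) + f2 i (p2 i)) * (b - a) / 3) * area0.
  have fE t : f1 i t + f2 i t = up t + down t by rewrite /f1 /f2; ring.
  have h := @chord_vs_climb_moment _ a b (f1 i) (f2 i) (p1 i) (p2 i) ab
    (@f1_cont i) (@f2_cont i) (f1_conc i) (f2_conc i) (p1P i) (p2P i).
  have e1 : \int_(a, b) (fun t => (t - a) * (f1 i t + f2 i t)) = area1.
    by apply: eq_int => t _; rewrite fE.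
  have e2 : \int_(a, b) (fun t => f1 i t + f2 i t) = area0.
    by apply: eq_int => t _; rewrite fE.
  rewrite e1 e2 in h.
  have aab : a <= a <= b by rewrite lexx ltW.
  apply: h; first by rewrite fE; exact: (chord_ge0 cptO rangeO aab).
  have mab : a <= (a + b) / 2 <= b by apply/andP; split; lra.
  have [_ /(_ _ mab) h1] := p1P i; have [_ /(_ _ mab) h2] := p2P i.
  have mab' : a < (a + b) / 2 < b by rewrite !midf_lt.
  have := chord_gt0 cptO cvxO intO cs1 ab rangeO mab'.
  by rewrite -fE => h0; apply: lt_le_trans h0 _; apply: lerD.
have n0R : 0 < n%:R^-1 :> R by rewrite invr_gt0 ltr0n.
have : 2 * (\sum_(0 <= i < n) (f1 i (p1 i) + f2 i (p2 i))) * area1 <=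
    (\sum_(0 <= i < n) \int_(a, b) (tail_at i) +
      (\sum_(0 <= i < n) (f1 i (p1 i) + f2 i (p2 i))) * ((b - a) / 3)) * area0.
  rewrite mulr_sumr !mulr_suml -big_split mulr_suml; apply: ler_sum => i _.
  by rewrite mulrA; exact: one.
rewrite tint /half_perimeter.
move: (\sum_(0 <= i < n) \int_(a, b) (tail_at i)) (\sum_(0 <= i < n) (f1 i (p1 i) + f2 i (p2 i))).
move=> N W; rewrite -(ler_pM2l n0R); lra.
Qed.

Let boundary_fin : (hausdorff1 (boundary Omega) < +oo)%E.
Proof. by apply: le_lt_trans perimeter_le _; rewrite ltry. Qed.

Let boundary_range z : boundary Omega z -> a <= dot z theta <= b.
Proof.
by move=> /(boundary_body cptO cvxO cs1 ab rangeO)[Oz _]; exact: (range_in rangeO).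
Qed.

Let tail_le_moment : ((\int_(a, b) tail)%:E <=
  \int[arclength]_(z in boundary Omega) (dot z theta - a)%:E + (2 * e * (b - a) ^+ 2)%:E)%E.
Proof.
have [mH ->] := @layer_cake _ C R arclength (boundary Omega) (fun z => dot z theta) a b
  measurable_boundary boundary_fin (measurable_dot_arclength (frame1 cs1)) boundary_range.
have -> : ((2 * e * (b - a) ^+ 2)%:E =
    \int[@lebesgue_measure R]_(t in `[a, b]) (2 * e * (b - a))%:E)%E.
  by rewrite integral_cst//= lebesgue_measure_itv/= lte_fin ab -EFinB -EFinM; congr (_%:E); ring.
have K0 : 0 <= 2 * e * (b - a) by rewrite !mulr_ge0 ?(ltW e0)// subr_ge0 ltW.
rewrite -ge0_integralD//=; last by move=> t _; exact: hausdorff1_ge0.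
rewrite /segint /Rintegral fineK; last first.
  by apply: integrable_fin_num => //; exact: continuous_integrable.
apply: ge0_le_integral => //.
- by apply/measurable_EFinP; apply: (measurable_funS measurableT) => //;
    exact: continuous_measurable.
- by apply: emeasurable_funD => //; exact: mH.
move=> t; rewrite /= in_itv/= => tab.
rewrite -leeBlDr// -EFinB; apply: le_trans (cap_ge tab).
rewrite lee_fin /tail lerD2l lerN2 ler_pM2l ?mulr_gt0//.
by move: tab => /andP[? ?]; lra.
Qed.

(** With [B] the difference of moments on the left, the claim is trivial for
    negative [B]; otherwise [L] is replaced by its upper bound and [Q] by its
    lower bound. *)
Lemma body_moments_le_approx (L Q : R) :
  hausdorff1 (boundary Omega) = L%:E ->
  (\int[arclength]_(z in boundary Omega) (dot z theta - a)%:E = Q%:E)%E ->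
  L * (area1 - (b - a) / 6 * area0) <= Q * area0 +
    e * (2 * (b - a) * `|area1 - (b - a) / 6 * area0| + 2 * (b - a) ^+ 2 * area0).
Proof.
move=> LE QE; have := perimeter_le; have := tail_le_moment; have := tail_moment.
rewrite LE QE -EFinD !lee_fin; move: (\int_(a, b) tail) => N.
set w := b - a; set B := area1 - w / 6 * area0 => hN hQ hL.
have w0 : 0 < w by rewrite subr_gt0.
have A0 : 0 <= area0 by exact/ltW/area_gt0.
have L0 : 0 <= L by rewrite -lee_fin -LE hausdorff1_ge0.
have Q0 : 0 <= Q.
  rewrite -lee_fin -QE; apply: integral_ge0 => z /boundary_range/andP[az _].
  by rewrite lee_fin subr_ge0.
have K0 : 0 <= e * (2 * w * `|B| + 2 * w ^+ 2 * area0).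
  by rewrite mulr_ge0 ?addr_ge0 ?mulr_ge0 ?sqr_ge0 ?(ltW e0) ?(ltW w0).
have [B0|B0] := leP 0 B; last first.
  apply: (@le_trans _ _ 0); first by rewrite mulr_ge0_le0// ltW.
  by rewrite addr_ge0// mulr_ge0.
rewrite ger0_norm//.
have h1 : L * B <= (2 * half_perimeter + 2 * e * w) * B by rewrite ler_wpM2r.
have h2 : N * area0 <= (Q + 2 * e * w ^+ 2) * area0 by rewrite ler_wpM2r.
have h3 : 2 * half_perimeter * B <= N * area0 by rewrite /B; lra.
lra.
Qed.

End body_measures.

(** * Comparison of the two centers *)

Section center_coordinate.
Context d (S : measurableType d) (R : realType) (mu : {measure set S -> \bar R}).

Lemma bounded_integrable (D : set S) (f : S -> R) (M : R) : measurable D ->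
  (mu D < +oo)%E -> measurable_fun [set: S] f -> (forall z, D z -> `|f z| <= M) ->
  mu.-integrable D (EFin \o f).
Proof.
move=> mD Dfin mf fM; apply: measurable_bounded_integrable => //.
  exact: measurable_funS mf.
by exists M; split=> [|x Mx z Dz]; [exact: num_real|exact: le_trans (fM z Dz) (ltW Mx)].
Qed.

(** The scalar product of a center of mass with [(c, s)], expressed by the
    first moment about [a]. *)
Lemma center_coordinate (D : set S) (x y : S -> R) (M a c s : R) : measurable D ->
  (mu D < +oo)%E -> 0 < fine (mu D) ->
  measurable_fun [set: S] x -> measurable_fun [set: S] y ->
  (forall z, D z -> `|x z| <= M) -> (forall z, D z -> `|y z| <= M) ->
  (\int[mu]_(z in D) x z) / fine (mu D) * c + (\int[mu]_(z in D) y z) / fine (mu D) * s =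
  a + (\int[mu]_(z in D) (x z * c + y z * s - a)) / fine (mu D).
Proof.
move=> mD Dfin D0 mx my xM yM.
have ix := bounded_integrable mD Dfin mx xM.
have iy := bounded_integrable mD Dfin my yM.
have ixc : mu.-integrable D (EFin \o (fun z => x z * c)).
  apply: (bounded_integrable (M := M * `|c|)) => //; first exact: measurable_funM.
  by move=> z Dz; rewrite normrM ler_wpM2r// xM.
have iys : mu.-integrable D (EFin \o (fun z => y z * s)).
  apply: (bounded_integrable (M := M * `|s|)) => //; first exact: measurable_funM.
  by move=> z Dz; rewrite normrM ler_wpM2r// yM.
have ixy : mu.-integrable D (EFin \o (fun z => x z * c + y z * s)).
  apply: (bounded_integrable (M := M * `|c| + M * `|s|)) => //.
    by apply: measurable_funD; apply: measurable_funM.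
  move=> z Dz; apply: le_trans (ler_normD _ _) _.
  by rewrite !normrM; apply: lerD; rewrite ler_wpM2r ?xM ?yM.
have ia : mu.-integrable D (EFin \o (fun=> a)).
  by apply: (bounded_integrable (M := `|a|)).
rewrite RintegralB//= RintegralD//= Rintegral_cst// !RintegralZr//.
by field; rewrite gt_eqF.
Qed.

End center_coordinate.

Section one_sided.
Context {R : realType}.
Variables (Omega : set (R * R)) (c s : R).
Hypothesis cptO : compact Omega.
Hypothesis cvxO : convex_set Omega.
Hypothesis intO : interior Omega !=set0.
Hypothesis cs1 : c ^+ 2 + s ^+ 2 = 1.

Local Notation theta := (c, s).
Local Notation eta := (- s, c).

Lemma body_range : exists a b, a < b /\
  [set dot z theta | z in Omega] = `[a, b]%classic.
Proof.
have O0 : Omega !=set0.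
  by have [z /interior_subset Oz] := intO; exists z.
have cth := continuous_subspaceT (@dot_continuous R theta).
have [zb + zbmax] := compact_EVT_max O0 cptO (cth Omega); rewrite inE => Ozb.
have [za + zamin] := compact_EVT_min O0 cptO (cth Omega); rewrite inE => Oza.
pose a := dot za theta; pose b := dot zb theta.
have rangeO : [set dot z theta | z in Omega] = `[a, b]%classic.
  apply/seteqP; split=> [_ [z Oz <-]|t]; rewrite /= in_itv/=.
    by rewrite zamin ?zbmax ?inE.
  move=> /andP[at_ tb]; have [ab|ba] := ltP a b; last first.
    by exists za => //; apply/eqP; rewrite eq_le at_/= (le_trans tb).
  have ab0 : 0 < b - a by rewrite subr_gt0.
  pose k := (b - t) / (b - a).
  have k01 : 0 <= k <= 1.
    by rewrite /k divr_ge0 ?subr_ge0 ?(ltW ab)//= ler_pdivrMr//; lra.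
  exists (k *: za + (1 - k) *: zb); first exact: convexP.
  rewrite dotDl !dotZl -/a -/b /k; field; by rewrite gt_eqF.
exists a, b; split=> //; have [z Iz] := intO.
by have [/andP[az zb'] _] := interior_strict cptO cvxO cs1 rangeO Iz; exact: lt_trans az zb'.
Qed.

Variables (a b : R).
Hypothesis ab : a < b.
Hypothesis rangeO : [set dot z theta | z in Omega] = `[a, b]%classic.
Local Notation up := (top Omega theta eta a b).
Local Notation down := (top Omega theta (- eta) a b).
Let area0 := \int_(a, b) (fun t => up t + down t).
Let area1 := \int_(a, b) (fun t => (t - a) * (up t + down t)).

Lemma boundary_length_gt0 : ((b - a)%:E <= hausdorff1 (boundary Omega))%E.
Proof.
apply: (hausdorff1_ge_projection (dot_lipschitz1 (frame1 cs1))); first exact: ltW.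
move=> t /andP[at_ tb]; have tab : a <= t <= b by rewrite !ltW.
exists (rot c s (t, up t)); last by rewrite rot_dot1.
apply/(boundary_body cptO cvxO cs1 ab rangeO); split.
  apply: (rot_mem_body cptO cvxO cs1 rangeO) => //.
  by have := chord_ge0 cptO rangeO tab => h; apply/andP; split; lra.
by constructor 3; rewrite rot_dot1// rot_dot2.
Qed.

Let approx e : 0 < e -> exists n (k p1 p2 : nat -> R), [/\ (0 < n)%N,
  forall x y : R, 0 <= x ->
  `|Num.sqrt (x ^+ 2 + y ^+ 2) - (\sum_(0 <= i < n) `|y - k i * x|) / n%:R| <= e * x,
  forall i, max_at a b (fun t => up t - k i * t) (p1 i) &
  forall i, max_at a b (fun t => down t - (- k i) * t) (p2 i)].
Proof.
move=> /euclidean_norm_mean[n [k [n0 nk]]]; exists n, k.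
have tilt_cont (f : R -> R) (l : R) : continuous f -> continuous (fun t => f t - l * t).
  by move=> cf t; apply: cvgB; [exact: cf|apply: cvgM; [exact: cvg_cst|exact: cvg_id]].
have cu : continuous up by exact: top_continuous.
have cd : continuous down by exact: top_continuous.
have /choice[p1 p1P] : forall i, exists p, max_at a b (fun t => up t - k i * t) p.
  by move=> i; apply: max_at_exists; [exact: ltW|exact: tilt_cont].
have /choice[p2 p2P] : forall i, exists p, max_at a b (fun t => down t - (- k i) * t) p.
  by move=> i; apply: max_at_exists; [exact: ltW|exact: tilt_cont].
by exists p1, p2.
Qed.

Lemma boundary_length_fin : (hausdorff1 (boundary Omega) < +oo)%E.
Proof.
have [n [k [p1 [p2 [n0 nk p1P p2P]]]]] := approx ltr01.
apply: le_lt_trans (perimeter_le cptO cvxO cs1 ab rangeO n0 nk p1P p2P) _.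
by rewrite ltry.
Qed.

Lemma body_moments_le (L Q : R) :
  hausdorff1 (boundary Omega) = L%:E ->
  (\int[arclength]_(z in boundary Omega) (dot z theta - a)%:E = Q%:E)%E ->
  L * (area1 - (b - a) / 6 * area0) <= Q * area0.
Proof.
move=> LE QE; apply/ler_addgt0Pr => e e0.
set K := 2 * (b - a) * `|area1 - (b - a) / 6 * area0| + 2 * (b - a) ^+ 2 * area0.
have K0 : 0 <= K.
  have := area_gt0 cptO cvxO intO cs1 ab rangeO; rewrite -/area0 => A0.
  have w0 : 0 <= b - a by rewrite subr_ge0 ltW.
  by rewrite addr_ge0 ?mulr_ge0 ?sqr_ge0 ?(ltW A0).
have d0 : 0 < e / (K + 1) by rewrite divr_gt0// ltr_wpDl.
have [n [k [p1 [p2 [n0 nk p1P p2P]]]]] := approx d0.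
apply: le_trans (body_moments_le_approx cptO cvxO intO cs1 ab rangeO d0 n0 nk p1P p2P LE QE) _.
rewrite lerD2l -/area0 -/area1 -/K mulrAC ler_pdivrMr ?ltr_wpDl//.
by rewrite ler_pM2l// lerDl.
Qed.

Let coord_bounded : exists M, forall z, Omega z -> `|z.1| <= M /\ `|z.2| <= M.
Proof.
have bnd w : exists M, forall z, Omega z -> `|dot z w| <= M.
  have [M [_ bM]] := compact_bounded (continuous_compact
    (continuous_subspaceT (@dot_continuous R w)) cptO).
  exists (`|M| + 1) => z Oz; apply: bM; last by exists z.
  by rewrite (le_lt_trans (ler_norm _))// ltrDl.
have [M1 b1] := bnd (1, 0); have [M2 b2] := bnd (0, 1).
exists (Num.max M1 M2) => z Oz; have := b1 z Oz; have := b2 z Oz.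
by rewrite /dot/= !mulr1 !mulr0 addr0 add0r !le_max => -> ->; rewrite orbT.
Qed.

Let area_body : area Omega = area0%:E.
Proof.
have := integral_body cptO cvxO cs1 ab rangeO (h := fun=> 1) (fun t => cvg_cst _) (fun=> fun=> ler01).
rewrite (integral_cst _ (measurable_body cptO cvxO cs1 ab rangeO)) mul1e => ->.
by congr (_%:E); apply: eq_int => t _; rewrite mul1r.
Qed.

Lemma one_sided_bound : dot (area_center Omega - boundary_center Omega) theta <= (b - a) / 6.
Proof.
have [M OM] := coord_bounded.
have A0 : 0 < area0 := area_gt0 cptO cvxO intO cs1 ab rangeO.
have mO := measurable_body cptO cvxO cs1 ab rangeO.
have mB := measurable_boundary cptO cvxO cs1 ab rangeO.
have Bfin := boundary_length_fin.
have LE : hausdorff1 (boundary Omega) = (fine (hausdorff1 (boundary Omega)))%:E.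
  by rewrite fineK// ge0_fin_numE// hausdorff1_ge0.
set L := fine _ in LE.
have L0 : 0 < L.
  have := boundary_length_gt0; rewrite LE lee_fin; apply: lt_le_trans.
  by rewrite subr_gt0.
have BO z : boundary Omega z -> Omega z.
  by move=> /(boundary_body cptO cvxO cs1 ab rangeO)[].
rewrite dotBl.
have -> : dot (area_center Omega) theta = a + area1 / area0.
  have Afin : (area Omega < +oo)%E by rewrite area_body ltry.
  have Apos : 0 < fine (area Omega) by rewrite area_body.
  have := @center_coordinate _ (measurableTypeR R * measurableTypeR R)%type R area Omega
    (fun z => z.1) (fun z => z.2) M a c s mO Afin Apos measurable_fst measurable_snd
    (fun z Oz => (OM z Oz).1) (fun z Oz => (OM z Oz).2).
  rewrite /dot/area_center/= => ->; rewrite area_body/=; congr (_ + _ / _).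
  have ca : continuous (fun t : R => t - a).
    by move=> t; apply: cvgB; [exact: cvg_id|exact: cvg_cst].
  have := integral_body cptO cvxO cs1 ab rangeO ca.
  rewrite /Rintegral /dot/= => -> //.
  by move=> t /andP[at_ _]; rewrite subr_ge0.
pose Q := \int[arclength]_(z in boundary Omega) (dot z theta - a).
have coord w : enorm w = 1 -> measurable_fun [set: caratheodory_type (@hausdorff1 R)]
    (fun z : caratheodory_type (@hausdorff1 R) => dot (z : R * R) w : R).
  by move=> w1; exact: measurable_dot_arclength.
have -> : dot (boundary_center Omega) theta = a + Q / L.
  have e1 : enorm ((1, 0) : R * R) = 1.
    by rewrite /enorm /dot/= mulr1 mulr0 addr0 sqrtr1.
  have e2 : enorm ((0, 1) : R * R) = 1.
    by rewrite /enorm /dot/= mulr1 mulr0 add0r sqrtr1.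
  have m1 : measurable_fun [set: caratheodory_type (@hausdorff1 R)]
      (fun z : caratheodory_type (@hausdorff1 R) => (z : R * R).1 : R).
    have := coord _ e1; congr (measurable_fun _ _).
    by apply/funext => z; rewrite /dot/= mulr1 mulr0 addr0.
  have m2 : measurable_fun [set: caratheodory_type (@hausdorff1 R)]
      (fun z : caratheodory_type (@hausdorff1 R) => (z : R * R).2 : R).
    have := coord _ e2; congr (measurable_fun _ _).
    by apply/funext => z; rewrite /dot/= mulr1 mulr0 add0r.
  exact: (@center_coordinate _ (caratheodory_type (@hausdorff1 R)) R arclength (boundary Omega)
    (fun z => z.1) (fun z => z.2) M a c s mB Bfin L0 m1 m2
    (fun z Bz => (OM z (BO z Bz)).1) (fun z Bz => (OM z (BO z Bz)).2)).
have QE : (\int[arclength]_(z in boundary Omega) (dot z theta - a)%:E = Q%:E)%E.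
  have mXa : measurable_fun [set: caratheodory_type (@hausdorff1 R)]
      (fun z : caratheodory_type (@hausdorff1 R) => dot (z : R * R) theta - a : R).
    by apply: measurable_funB; [exact: coord (frame1 cs1)|exact: measurable_cst].
  have bnd z : boundary Omega z -> `|dot z theta - a| <= b - a.
    by move=> /BO/(range_in rangeO)/andP[az zb]; rewrite ger0_norm ?subr_ge0// lerD2r.
  have iQ := @bounded_integrable _ (caratheodory_type (@hausdorff1 R)) R arclength
    (boundary Omega) (fun z => dot z theta - a) (b - a) mB Bfin mXa bnd.
  have fQ := integrable_fin_num mB iQ.
  by rewrite /Q /Rintegral (fineK fQ).
have := body_moments_le LE QE; rewrite -/area0 -/area1 => h.
rewrite (_ : _ - _ = area1 / area0 - Q / L); last by ring.
rewrite lerBlDr -(ler_pM2r A0) mulfVK ?gt_eqF//.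
rewrite -(ler_pM2l L0).
have -> : L * (((b - a) / 6 + Q / L) * area0) = L * ((b - a) / 6 * area0) + Q * area0.
  by field; rewrite gt_eqF.
lra.
Qed.

End one_sided.

Section width.
Context {R : realType}.

Lemma width_itv (Omega : set (R * R)) (theta : R * R) (a b : R) : a < b ->
  [set dot z theta | z in Omega] = `[a, b]%classic -> width Omega theta = b - a.
Proof.
by move=> ab rangeO; rewrite /width rangeO sup_itv ?inf_itv// bnd_simp ltW.
Qed.

Lemma widthN (Omega : set (R * R)) (theta : R * R) :
  width Omega (- theta) = width Omega theta.
Proof.
rewrite /width (_ : [set dot z (- theta) | z in Omega] = -%R @` [set dot z theta | z in Omega]).
  by rewrite /inf setNK !opprK addrC.
apply/seteqP; split => [_ [z Oz <-]|_ [_ [z Oz <-] <-]].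
  by exists (dot z theta); [exists z|rewrite dotNr].
by exists z; rewrite ?dotNr.
Qed.
End width.

Theorem mainTheorem1 (R : realType) (Omega : set (R * R))
    (compact_Omega : compact Omega)
    (convex_Omega : convex_set Omega)
    (interior_Omega : interior Omega !=set0)
    (theta : R * R) (unit_theta : enorm theta = 1) :
  `| dot (boundary_center Omega - area_center Omega) theta |
    <= 6^-1 * width Omega theta.
Proof.
have one_side (nu : R * R) : enorm nu = 1 ->
    dot (area_center Omega - boundary_center Omega) nu <= 6^-1 * width Omega nu.
  case: nu => c s nu1.
  have cs1 : c ^+ 2 + s ^+ 2 = 1.
    by have := enorm_sqr (c, s); rewrite nu1 expr1n /dot/= -!expr2.
  have [a [b [ab rangeO]]] := body_range compact_Omega convex_Omega interior_Omega cs1.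
  rewrite (width_itv ab rangeO) mulrC.
  exact: (one_sided_bound compact_Omega convex_Omega interior_Omega cs1 ab rangeO).
have unitN : enorm (- theta) = 1.
  by rewrite -unit_theta /enorm /dot/=; congr Num.sqrt; ring.
have := one_side _ unit_theta; have := one_side _ unitN.
rewrite widthN dotNr !dotBl => h1 h2.
by rewrite ler_norml; apply/andP; split; lra.
Qed.
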